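(* Let $\mathcal{C}$ be a crystal framework in $\mathbb{R}^d$ ($d\ge 2$) and fix a periodic structure $a_1,\dots,a_d$ and a motif $(F_v,F_e)$ for it, with $n=|F_v|$, $m=|F_e|$. The following statements are equivalent. (i) $\mathcal{C}$ is first-order rigid, i.e. $\mathcal{F}(\mathcal{C};\mathbb{C})=\mathcal{F}_{\rm rig}(\mathcal{C};\mathbb{C})$. (ii) $\mathcal{C}$ is exponentially rigid, i.e. $\mathcal{F}_{\rm exp}(\mathcal{C};\mathbb{C})=\mathcal{F}_{\rm rig}(\mathcal{C};\mathbb{C})$. (iii) For the given periodic structure, every factor-periodic flex of $\mathcal{C}$ and every flexible lattice periodic flex of $\mathcal{C}$ lies in $\mathcal{F}_{\rm rig}(\mathcal{C};\mathbb{C})$ (there are no nontrivial ones). (iv) The transfer function $\Psi_{\mathcal{C}}(z)$ and the matrix $R_{\rm fper}(\mathcal{C})$ are rank extremal, i.e. $\operatorname{rank}\Psi_{\mathcal{C}}(z)=dn$ for all $z\in(\mathbb{C}\setminus\{0\})^d\setminus\{(1,\dots,1)\}$, $\operatorname{rank}\Psi_{\mathcal{C}}(1,\dots,1)=dn-d$, and $\operatorname{rank}R_{\rm fper}(\mathcal{C})=dn+d(d-1)/2$. (v) The $\mathbb{C}(z)$-module $M(\mathcal{C})$ equals the rigidity module $M_{\rm rig}(\mathcal{C})$.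
   Context: A crystal framework $\mathcal{C}=(G,p)$ in $\mathbb{R}^d$ consists of a countable simple graph $G=(V,E)$ and an injective placement $p:V\to\mathbb{R}^d$ such that, for some linearly independent vectors $a_1,\dots,a_d\in\mathbb{R}^d$ (a periodic structure), $\mathbb{Z}^d$ acts on $G$ by graph automorphisms $v\mapsto k\cdot v$ with $p(k\cdot v)=p(v)+k_1a_1+\dots+k_da_d$, with finitely many orbits of vertices and of edges. A motif is a set $F_v=\{v_1,\dots,v_n\}$ of orbit representatives of vertices and a set $F_e$ of $m$ orbit representatives of edges. Write $(v,k)$ for the vertex $k\cdot v$ ($v\in F_v$, $k\in\mathbb{Z}^d$); each motif edge is written $e=(v,k)(w,l)$ with $v,w\in F_v$, and $p(e)=p(v,k)-p(w,l)\in\mathbb{R}^d$ (a row vector). A complex velocity field is a map $u:V\to\mathbb{C}^d$, identified with $u\in C(\mathbb{Z}^d;\mathbb{C}^{dn})$ via $u(k)=(u(v_1,k),\dots,u(v_n,k))$. It is an infinitesimal (first-order) flex if $(u(x)-u(y))\cdot(p(x)-p(y))=0$ for every edge $xy\in E$ (bilinear dot product); these form $\mathcal{F}(\mathcal{C};\mathbb{C})$. $\mathcal{F}_{\rm rig}(\mathcal{C};\mathbb{C})$ is the complex linear span of the rigid-motion flexes $x\mapsto Sp(x)+b$ ($S$ a real skew-symmetric $d\times d$ matrix, $b\in\mathbb{R}^d$). For $\omega\in\mathbb{C}_*^d=(\mathbb{C}\setminus\{0\})^d$, $k\in\mathbb{Z}^d$, write $\omega^k=\omega_1^{k_1}\cdots\omega_d^{k_d}$.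 $\mathcal{V}_{\rm exp}(\mathcal{C};\mathbb{C})$ is the linear span of all fields $k\mapsto q(k)\omega^k a$ with $\omega\in\mathbb{C}_*^d$, $q\in\mathbb{C}[z_1,\dots,z_d]$, $a\in\mathbb{C}^{dn}$; $\mathcal{F}_{\rm exp}=\mathcal{V}_{\rm exp}\cap\mathcal{F}$. A factor-periodic flex with multi-factor $\omega\in\mathbb{C}_*^d$ is a flex with $u(k)=\omega^k u(0)$ for all $k$. A flexible lattice periodic flex is a flex of the form $u(k)=u(0)+(Xk,\dots,Xk)$ for some $X\in M_d(\mathbb{C})$. $\mathbb{C}(z)$ denotes the Laurent polynomial ring in $z_1,\dots,z_d$. The transfer function $\Psi_{\mathcal{C}}(z)$ is the $m\times dn$ matrix over $\mathbb{C}(z)$ with rows indexed by motif edges and columns grouped in $n$ blocks of $d$ indexed by $F_v$: for $e=(v,k)(w,l)$ with $v\neq w$ the row has $p(e)z^{-k}$ in block $v$, $-p(e)z^{-l}$ in block $w$ and zeros elsewhere; if $v=w$ it has $p(e)(z^{-k}-z^{-l})$ in block $v$ and zeros elsewhere. $M(\mathcal{C})$ is the $\mathbb{C}(z)$-submodule of $\mathbb{C}(z)\otimes\mathbb{C}^{dn}$ generated by the rows of $\Psi_{\mathcal{C}}$. The matrix $R_{\rm fper}(\mathcal{C})$ is the $m\times(dn+d^2)$ scalar matrix whose row for $e=(v,k)(w,l)$ with $v\ne w$ has $p(e)$ in block $v$, $-p(e)$ in block $w$, zeros in the other vertex blocks, followed by the $d$ blocks $(l_1-k_1)p(e),\dots,(l_d-k_d)p(e)$;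 if $v=w$ the vertex blocks are zero and the last $d$ blocks are $(l_1-k_1)p(e),\dots,(l_d-k_d)p(e)$. For $P=\sum_k a_kz^k\in\mathbb{C}(z)\otimes\mathbb{C}^{dn}$ ($a_k\in\mathbb{C}^{dn}$, finitely many nonzero) and $u\in C(\mathbb{Z}^d;\mathbb{C}^{dn})$ set $\langle P,u\rangle=\sum_k a_k\cdot u(-k)$. The rigidity module is $M_{\rm rig}(\mathcal{C})=\{P\in\mathbb{C}(z)\otimes\mathbb{C}^{dn}:\langle P,u\rangle=0\ \text{for all } u\in\mathcal{F}_{\rm rig}(\mathcal{C};\mathbb{C})\}$. *)

(* Defs.v *)
From HB Require Import structures.
From mathcomp Require Import all_boot all_order all_algebra.
From mathcomp Require Import reals.
From mathcomp Require Import complex.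
From mathcomp Require mpoly.
Set Implicit Arguments. Unset Strict Implicit. Unset Printing Implicit Defensive.
Import Order.TTheory GRing.Theory Num.Theory.
Local Open Scope ring_scope.

(* list membership in Prop (for element types without eqType instance) *)
Fixpoint inl (T : Type) (x : T) (s : seq T) : Prop :=
  if s is y :: s' then y = x \/ inl x s' else False.

Section Crystal.
Variables (R : realType) (d n m : nat).
Local Notation C := (complex R).

(* A crystal framework given through a periodic structure and a motif.
   Vertices are pairs (v,k) : 'I_n * Z^d, standing for the vertex k.v;
   motif vertex v is (v,0).  Motif edge e is (esrc e, eshk e)(etgt e, eshl e). *)
Record crystal := Crystal {
  cper : 'M[R]_d;             (* row i = periodicity vector a_(i+1) *)
  cpos : 'I_n -> 'rV[R]_d;
  esrc : 'I_m -> 'I_n;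
  etgt : 'I_m -> 'I_n;
  eshk : 'I_m -> 'rV[int]_d;
  eshl : 'I_m -> 'rV[int]_d
}.

Variable X : crystal.

Definition vtx := ('I_n * 'rV[int]_d)%type.

Definition intv (k : 'rV[int]_d) : 'rV[R]_d := map_mx (fun z : int => z%:~R) k.
Definition intvC (k : 'rV[int]_d) : 'rV[C]_d := map_mx (fun z : int => z%:~R) k.
Definition toC (r : R) : C := real_complex R r.

Definition place (x : vtx) : 'rV[R]_d := cpos X x.1 + intv x.2 *m cper X.
Definition placeC (x : vtx) : 'rV[C]_d := map_mx toC (place x).

Definition ends (e : 'I_m) (j : 'rV[int]_d) : vtx * vtx :=
  ((esrc X e, eshk X e + j), (etgt X e, eshl X e + j)).

Definition is_edge (x y : vtx) : Prop :=
  exists e j, ends e j = (x, y) \/ ends e j = (y, x).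

(* standing assumptions: a_i linearly independent, p injective, G simple
   (no loops), motif edges are representatives of pairwise distinct orbits *)
Definition is_crystal : Prop :=
  [/\ cper X \in unitmx,
      injective place,
      (forall e, (esrc X e, eshk X e) != (etgt X e, eshl X e)) &
      (forall e e' j, ends e j = ends e' 0 \/ ends e j = ((ends e' 0).2, (ends e' 0).1) ->
          e = e')].

(* complex velocity fields u : V -> C^d, identified with Z^d -> C^{dn};
   u k is the n x d matrix whose row v is u(v,k) *)
Definition vfield := 'rV[int]_d -> 'M[C]_(n, d).
Definition vel (u : vfield) (x : vtx) : 'rV[C]_d := row x.1 (u x.2).
Definition dotC (a b : 'rV[C]_d) : C := (a *m b^T) 0 0.

Definition is_flex (u : vfield) : Prop :=
  forall x y, is_edge x y -> dotC (vel u x - vel u y) (placeC x - placeC y) = 0.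

(* rigid motion flex x |-> S p(x) + b (written for row vectors) *)
Definition rigid_flex (S : 'M[R]_d) (b : 'rV[R]_d) : vfield :=
  fun k => \matrix_(v < n, i < d)
    ((map_mx toC (place (v, k) *m S^T + b)) 0 i).

Definition in_Frig (u : vfield) : Prop :=
  exists s : seq (C * 'M[R]_d * 'rV[R]_d),
    (forall t, inl t s -> (t.1.2)^T = - t.1.2) /\
    forall k, u k = \sum_(t <- s) t.1.1 *: rigid_flex t.1.2 t.2 k.

Definition zpow (w : 'rV[C]_d) (k : 'rV[int]_d) : C := \prod_(i < d) (w 0 i) ^ (k 0 i).
Definition nonzero_entries (w : 'rV[C]_d) : Prop := forall i, w 0 i != 0.

Definition in_Vexp (u : vfield) : Prop :=
  exists s : seq ('rV[C]_d * mpoly.mpoly d C * 'M[C]_(n, d)),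
    (forall t, inl t s -> nonzero_entries t.1.1) /\
    forall k, u k = \sum_(t <- s)
       (mpoly.meval (fun i => (k 0 i)%:~R) t.1.2 * zpow t.1.1 k) *: t.2.

Definition first_order_rigid : Prop := forall u, is_flex u <-> in_Frig u.
Definition exp_rigid : Prop := forall u, (in_Vexp u /\ is_flex u) <-> in_Frig u.

Definition factor_periodic_flex (w : 'rV[C]_d) (u : vfield) : Prop :=
  is_flex u /\ forall k, u k = zpow w k *: u 0.
Definition flexible_lattice_periodic_flex (u : vfield) : Prop :=
  is_flex u /\ exists Xm : 'M[C]_d,
    forall k, u k = u 0 + \matrix_(v < n, i < d) ((intvC k *m Xm^T) 0 i).

Definition no_nontrivial_periodic_flexes : Prop :=
  (forall w u, nonzero_entries w -> factor_periodic_flex w u -> in_Frig u) /\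
  (forall u, flexible_lattice_periodic_flex u -> in_Frig u).

Definition blk (v : 'I_n) (a : 'rV[C]_d) : 'rV[C]_(n * d) :=
  mxvec (\matrix_(u < n, i < d) (if u == v then a 0 i else 0)).

Definition pe (e : 'I_m) : 'rV[R]_d :=
  place (esrc X e, eshk X e) - place (etgt X e, eshl X e).
Definition peC (e : 'I_m) : 'rV[C]_d := map_mx toC (pe e).

(* Laurent polynomials / elements of C(z) (x) C^{dn} as finite formal sums *)
Definition lpoly := seq ('rV[int]_d * C).
Definition lvec := seq ('rV[int]_d * 'rV[C]_(n * d)).
Definition lcoef (P : lvec) (k : 'rV[int]_d) : 'rV[C]_(n * d) :=
  \sum_(x <- P | x.1 == k) x.2.
Definition lmul (f : lpoly) (P : lvec) : lvec :=
  [seq (x.1 + y.1, x.2 *: y.2) | x <- f, y <- P].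
Definition lveval (P : lvec) (z : 'rV[C]_d) : 'rV[C]_(n * d) :=
  \sum_(x <- P) zpow z x.1 *: x.2.

(* row e of the transfer function: p(e) z^{-k} in block v, -p(e) z^{-l} in
   block w (when v = w these add up to p(e)(z^{-k} - z^{-l}) in block v) *)
Definition Psi_row (e : 'I_m) : lvec :=
  [:: (- eshk X e, blk (esrc X e) (peC e)); (- eshl X e, - blk (etgt X e) (peC e))].
Definition Psi_at (z : 'rV[C]_d) : 'M[C]_(m, n * d) :=
  \matrix_(e < m) lveval (Psi_row e) z.

Definition R_fper : 'M[R]_(m, n * d + d * d) :=
  row_mx
    (\matrix_(e < m) mxvec (\matrix_(u < n, i < d)
        (((u == esrc X e)%:R - (u == etgt X e)%:R) * pe e 0 i)))
    (\matrix_(e < m) mxvec (\matrix_(j < d, i < d)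
        ((eshl X e 0 j - eshk X e 0 j)%:~R * pe e 0 i))).

Definition rank_extremal : Prop :=
  [/\ (forall z, nonzero_entries z -> z != const_mx 1 -> \rank (Psi_at z) = (n * d)%N),
      \rank (Psi_at (const_mx 1)) = (n * d - d)%N &
      \rank R_fper = (n * d + (d * d.-1) %/ 2)%N].

Definition in_M (P : lvec) : Prop :=
  exists f : 'I_m -> lpoly, forall k,
    lcoef P k = lcoef (flatten [seq lmul (f e) (Psi_row e) | e <- enum 'I_m]) k.

Definition lpair (P : lvec) (u : vfield) : C :=
  \sum_(x <- P) (x.2 *m (mxvec (u (- x.1)))^T) 0 0.

Definition in_Mrig (P : lvec) : Prop := forall u, in_Frig u -> lpair P u = 0.

Definition module_eq : Prop := forall P, in_M P <-> in_Mrig P.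

End Crystal.

(* Main.v *)
(** Pairing finitely supported vectors with velocity fields identifies flexes with
    the linear functionals on C(z)^(dn) that vanish on the rows of the transfer
    function.  If no factor-periodic flex has a multi-factor with i-th entry
    different from 1, then a Nullstellensatz for modules over the uncountable field C
    makes every flex nilpotent under the i-th difference operator: a submodule
    maximal among those containing no power of (z_i - 1) C(z)^(dn) has only scalar
    shifts on its quotient, which yields a factor-periodic flex.  A flex whose
    differences are all rigid is then affine in the lattice variable, because a
    trilinear form that is symmetric in two arguments and skew in two others is zero;
    induction on the nilpotency orders shows that every flex is rigid.  The rank
    conditions say that the kernels consist of rigid motions only, and the module
    condition is the dual form, by separation of points from subspaces. *)

Require Import Defs.
From HB Require Import structures.
From mathcomp Require Import all_boot all_order all_algebra.
From mathcomp Require Import all_classical.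
From mathcomp Require Import reals complex finmap.
From mathcomp Require mpoly monalg.
Import monalg.
From mathcomp Require Import ring lra zify.

Set Implicit Arguments. Unset Strict Implicit. Unset Printing Implicit Defensive.
Import Order.TTheory GRing.Theory Num.Theory.
Local Open Scope classical_set_scope.
Local Open Scope ring_scope.

(** * Uncountability of the real line *)

Section Uncountable.
Variable R : realType.

(** Cantor's nested intervals: each step keeps a closed part of the previous interval that misses
    [x k']. Since [x k'] may be the midpoint itself, the right quarter is kept in that case and not
    the right half. *)
Fixpoint nested (x : nat -> R) (k : nat) : R * R :=
  if k is k'.+1 then
    let: (a, b) := nested x k' in
    if x k' <= (a + b) / 2 then ((a + 3 * b) / 4, b) else (a, (a + b) / 2)
  else (0, 1).

Lemma nested_lt (x : nat -> R) k : (nested x k).1 < (nested x k).2.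
Proof.
elim: k => [|k] /=; first exact: ltr01.
by case: (nested x k) => a b /= ab; case: ifP => _ /=; lra.
Qed.

Lemma nested_step (x : nat -> R) k :
  (nested x k).1 <= (nested x k.+1).1 /\ (nested x k.+1).2 <= (nested x k).2.
Proof.
have /= := nested_lt x k; case: (nested x k) => a b /= ab.
by case: ifP => _ /=; split; lra.
Qed.

Lemma nested_mono (x : nat -> R) k l : (k <= l)%N ->
  (nested x k).1 <= (nested x l).1 /\ (nested x l).2 <= (nested x k).2.
Proof.
elim: l => [|l IH]; first by rewrite leqn0 => /eqP ->.
rewrite leq_eqVlt => /predU1P[-> //|/IH[h1 h2]].
by have [h3 h4] := nested_step x l; split; [apply: le_trans h3|apply: le_trans h4 _].
Qed.

Lemma nested_avoid (x : nat -> R) : exists y, forall k, x k != y.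
Proof.
pose A := [set (nested x k).1 | k in [set: nat]].
have ub k : ubound A (nested x k).2.
  move=> _ [l _ <-]; have [h1 _] := nested_mono x (leq_maxl l k).
  have [_ h2] := nested_mono x (leq_maxr l k).
  by apply/(le_trans h1)/(le_trans _ h2)/ltW/nested_lt.
have hA : has_sup A by split; [exists 0; exists 0%N|exists 1; exact: (ub 0%N)].
(* Every right endpoint bounds all left endpoints, so the supremum lies in every interval. *)
exists (sup A) => k; apply/negP => /eqP xk.
have h2 : sup A <= (nested x k.+1).2 by apply: ge_sup; [case: hA|exact: ub].
have h1 : (nested x k.+1).1 <= sup A by apply: ub_le_sup; [case: hA|exists k.+1].
move: h1 h2; rewrite -xk /=; have := nested_lt x k.
by case: (nested x k) => a b /= ab; case: ifP => /= h; lra.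
Qed.

Lemma real_uncountable : ~ countable [set: R].
Proof.
move=> /countable_injP[f finj].
(* Inverting the injection enumerates all reals; numbers that [f] does not reach are sent to 0. *)
have [y hy] := nested_avoid (fun k => xget 0 [set r | f r = k]).
move/eqP: (hy (f y)); apply; case: xgetP => [z _ /= fz|/(_ y)/(_ erefl)//].
by apply: finj; rewrite ?in_setT.
Qed.

(** Pigeonhole: otherwise the line would be a countable union of finite sets. *)
Lemma real_infinite_fiber (g : R -> nat) : exists i, infinite_set (g @^-1` [set i]).
Proof.
apply: contrapT => /forallNP h; apply: real_uncountable.
have -> : [set: R] = \bigcup_(i in [set: nat]) (g @^-1` [set i]).
  by apply/seteqP; split => // x _; exists (g x).
apply: bigcup_countable => // i _; apply: finite_set_countable.
exact: contrapT (h i).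
Qed.

End Uncountable.

(** * Stable submodules, Zorn's lemma and separation *)

Section Submodules.
Variables (F : fieldType) (E : lmodType F) (I : Type) (T : I -> E -> E).

(** With the lattice shifts as operators these are the modules over Laurent polynomials; with
    operators indexed by the empty type they are plain linear subspaces. *)
Definition submod (W : set E) : Prop :=
  [/\ W 0, forall a x y, W x -> W y -> W (a *: x + y)
    & forall i x, W x -> W (T i x)].

Lemma submodD W x y : submod W -> W x -> W y -> W (x + y).
Proof. by case=> _ h _ Wx Wy; rewrite -[x]scale1r; apply: h. Qed.

Lemma submodZ W a x : submod W -> W x -> W (a *: x).
Proof. by case=> W0 h _ Wx; rewrite -[a *: x]addr0; apply: h. Qed.

Lemma submodN W x : submod W -> W x -> W (- x).
Proof. by rewrite -scaleN1r; apply: submodZ. Qed.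

Lemma submodB W x y : submod W -> W x -> W y -> W (x - y).
Proof. by move=> sW Wx Wy; apply: submodD => //; apply: submodN. Qed.

Lemma submod_sum W (J : Type) (s : seq J) (f : J -> E) : submod W ->
  (forall j, W (f j)) -> W (\sum_(j <- s) f j).
Proof.
move=> sW h; elim: s => [|j s IH]; first by rewrite big_nil; case: sW.
by rewrite big_cons; apply: submodD.
Qed.

(** Zorn's lemma. For each [k] only finitely many vectors [g k j] are involved, so if the union of a
    chain contains all of them, one member of the chain already does. *)
Lemma exists_maximal_submod r (g : nat -> 'I_r -> E) (M : set E) :
  submod M -> ~ (exists k, forall j, M (g k j)) ->
  exists W, [/\ submod W, M `<=` W, ~ (exists k, forall j, W (g k j))
    & forall V, submod V -> W `<=` V -> ~ (exists k, forall j, V (g k j)) -> V `<=` W].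
Proof.
move=> sM gM.
(* Sets are taken through their union with [M], so that the empty chain, whose union is empty,
   stands for [M] itself. *)
pose P := [set A | submod (M `|` A) /\ ~ (exists k, forall j, (M `|` A) (g k j))].
have [|A [[sA gA] maxA]] := @Zorn_bigcup _ P.
  move=> Ch ChP Chtot; have [->|/set0P[A0 ChA0]] := eqVneq Ch set0.
    by rewrite bigcup_set0 /P /mkset setU0; split.
  have fin (s : seq E) : (forall x, x \in s -> (M `|` \bigcup_(A in Ch) A) x) ->
      exists2 A, Ch A & forall x, x \in s -> (M `|` A) x.
    elim: s => [|x s IH] h; first by exists A0.
    have [y ys|A ChA hA] := IH; first by apply: h; rewrite inE ys orbT.
    have [Mx|[B ChB Bx]] := h x (mem_head _ _).
      by exists A => // y; rewrite inE => /predU1P[->|/hA//]; left.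
    have [AB|BA] := Chtot _ _ ChA ChB.
      exists B => // y; rewrite inE => /predU1P[->|/hA]; first by right.
      by case=> [|/AB]; [left|right].
    by exists A => // y; rewrite inE => /predU1P[->|/hA//]; right; apply: BA.
  have sub A : Ch A -> M `|` A `<=` M `|` \bigcup_(A in Ch) A.
    by move=> ChA x [Mx|Ax]; [left|right; exists A].
  split; last first.
    move=> [k hk]; have [x|A ChA hA] := fin [seq g k j | j <- enum 'I_r].
      by case/mapP => j _ ->.
    have [_] := ChP _ ChA; apply; exists k => j; apply: hA.
    by apply: map_f; rewrite mem_enum.
  split; first by left; case: sM.
    move=> a x y hx hy; have [z|A ChA hA] := fin [:: x; y].
      by rewrite !inE => /orP[] /eqP ->.
    have [[_ hl _] _] := ChP _ ChA.
    by apply: (sub A ChA); apply: hl; apply: hA; rewrite !inE eqxx ?orbT.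
  move=> i x hx; have [z|A ChA hA] := fin [:: x]; first by rewrite inE => /eqP ->.
  have [[_ _ hl] _] := ChP _ ChA.
  by apply: (sub A ChA); apply: hl; apply: hA; rewrite inE.
exists (M `|` A); split => // V sV WV gV; apply: contrapT => nVW.
have MV : M `|` V = V.
  by apply/setUidPr => x Mx; apply: WV; left.
apply: (maxA V); last by rewrite /P /mkset MV; split.
split; last by move=> VA; apply: nVW => x /VA; right.
by move=> x Ax; apply: WV; right.
Qed.

End Submodules.

(** A subspace containing [M] and maximal among those missing [p] is a hyperplane complementary to
    the line of [p]; the functional is the coordinate along [p] modulo that hyperplane. *)
Lemma separating_functional (F : fieldType) (E : lmodType F) (I : Type)
    (T : I -> E -> E) (M : set E) (p : E) :
  submod T M -> ~ M p ->
  exists phi : E -> F, [/\ forall a x y, phi (a *: x + y) = a * phi x + phi y,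
    forall x, M x -> phi x = 0 & phi p = 1].
Proof.
move=> [M0 Ml _] Mp; pose T0 := fun (i : void) (x : E) => x.
have sM0 : submod T0 M by [].
have [|W [sW MW Wp maxW]] := @exists_maximal_submod F E void T0 1 (fun _ _ => p) M sM0.
  by case=> _ /(_ 0).
have {}Wp : ~ W p by move=> h; apply: Wp; exists 0%N.
have ex x : exists c, W (x - c *: p).
  have [Wx|Wx] := pselect (W x); first by exists 0; rewrite scale0r subr0.
  (* For [x] outside [W], the larger space spanned by [W] and [x] contains [p] by maximality, and
     the coefficient [a] of [x] is nonzero because [p] is not in [W]. *)
  pose V := [set y | exists a, W (y - a *: x)].
  have sV : submod T0 V.
    split=> //; first by exists 0; rewrite scale0r subr0; case: sW.
    move=> c y z [a ha] [b hb]; exists (c * a + b).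
    rewrite scalerDl opprD addrACA -scalerA -scalerBr.
    by case: sW => _ h _; apply: h.
  have WV : W `<=` V by move=> y Wy; exists 0; rewrite scale0r subr0.
  have [Vp|Vp] := pselect (V p); last first.
    case: Wx; apply: (maxW V sV WV); first by case=> _ /(_ 0).
    by exists 1; rewrite scale1r subrr; case: sW.
  case: Vp => a Wpa; exists a^-1.
  have a0 : a != 0 by apply/eqP => a0; move: Wpa; rewrite a0 scale0r subr0.
  rewrite -[x in W (x - _)]scale1r -(mulVf a0) -scalerA -scalerBr.
  by apply: (submodZ _ sW); rewrite -opprB; apply: (submodN sW).
have uni x c c' : W (x - c *: p) -> W (x - c' *: p) -> c = c'.
  move=> h h'; apply/eqP; rewrite -subr_eq0; apply/negPn/negP => nz; apply: Wp.
  have := submodB sW h' h; rewrite opprB addrC addrA subrK -scalerBl => /(submodZ (c - c')^-1 sW).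
  by rewrite scalerA mulVf // scale1r.
pose phi x := projT1 (cid (ex x)).
have phiP x : W (x - phi x *: p) by rewrite /phi; case: cid.
exists phi; split.
- move=> a x y; apply: (uni _ _ _ (phiP _)).
  rewrite scalerDl opprD addrACA -scalerA -scalerBr.
  by case: sW => _ h _; apply: h.
- by move=> x /MW Wx; apply: (uni _ _ _ (phiP _)); rewrite scale0r subr0.
- by apply: (uni _ _ _ (phiP _)); rewrite scale1r subrr; case: sW.
Qed.

(** * Polynomials in one linear operator *)

Section PolynomialAction.
Variables (F : fieldType) (E : lmodType F) (T : {linear E -> E}).

Definition pact (p : {poly F}) (x : E) : E := \sum_(i < size p) p`_i *: iter i T x.

Lemma pact_widen N (p : {poly F}) x : (size p <= N)%N -> pact p x = \sum_(i < N) p`_i *: iter i T x.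
Proof.
move=> le; rewrite /pact (big_ord_widen _ (fun i => p`_i *: iter i T x) le).
rewrite big_mkcond; apply: eq_bigr => i _; case: ltnP => // h.
by rewrite nth_default // scale0r.
Qed.

Lemma pactD p q x : pact (p + q) x = pact p x + pact q x.
Proof.
pose N := maxn (size p) (size q).
rewrite (@pact_widen N) ?size_polyD // (@pact_widen N p) ?leq_maxl //.
rewrite (@pact_widen N q) ?leq_maxr // -big_split; apply: eq_bigr => i _.
by rewrite coefD scalerDl.
Qed.

Lemma pactZ a p x : pact (a *: p) x = a *: pact p x.
Proof.
rewrite (@pact_widen (size p)) ?size_scale_leq // scaler_sumr.
by apply: eq_bigr => i _; rewrite coefZ scalerA.
Qed.

Lemma pact0 x : pact 0 x = 0.
Proof. by rewrite /pact size_poly0 big_ord0. Qed.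

Lemma pact_sum (J : Type) (s : seq J) (f : J -> {poly F}) x :
  pact (\sum_(j <- s) f j) x = \sum_(j <- s) pact (f j) x.
Proof.
elim: s => [|j s IH]; first by rewrite !big_nil pact0.
by rewrite !big_cons pactD IH.
Qed.

Lemma iter_linear k a x y : iter k T (a *: x + y) = a *: iter k T x + iter k T y.
Proof. by elim: k => //= k ->; rewrite linearP. Qed.

Lemma pact_linear p a x y : pact p (a *: x + y) = a *: pact p x + pact p y.
Proof.
rewrite /pact scaler_sumr -big_split; apply: eq_bigr => i _ /=.
by rewrite iter_linear scalerDr !scalerA [a * _]mulrC.
Qed.

(** Serves twice: to remove the roots of a polynomial one at a time, and to insert a resolvent
    equation (T - c) y = x. *)
Lemma pact_mulXsub (p : {poly F}) c x : pact (p * ('X - c%:P)) x = pact p (T x - c *: x).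
Proof.
have le : leq (size (p * ('X - c%:P))) (size p).+1.
  by rewrite (leq_trans (size_polyMleq _ _)) // size_XsubC addn2.
rewrite (pact_widen x le) mulrBr.
under eq_bigr => i _ do rewrite coefB coefMX coefMC scalerBl.
rewrite sumrB big_ord_recl scale0r add0r big_ord_recr /=.
rewrite (nth_default _ (leqnn (size p))) mul0r scale0r addr0 -sumrB.
apply: eq_bigr => i _; rewrite [T x - _]addrC -[- (c *: x)]scaleNr iter_linear -iterSr.
by rewrite scaleNr scalerDr scalerN scalerA addrC.
Qed.

End PolynomialAction.

(** * A Nullstellensatz for finitely generated modules over commuting operators *)

Section Nullstellensatz.
Variables (R : realType).
Local Notation C := (complex R).
Variables (E : lmodType C) (I : Type) (T : I -> {linear E -> E}).
Hypothesis Tcomm : forall i j x, T i (T j x) = T j (T i x).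
Local Notation Tf := (fun i => T i : E -> E).
Variables (r : nat) (e : 'I_r -> E).
Hypothesis egen : forall W, submod Tf W -> (forall j, W (e j)) -> forall x, W x.
Variable b : nat -> E.
Hypothesis bspan : forall x, exists N (c : 'rV[C]_N), x = \sum_(i < N) c 0 i *: b i.
Variable i0 : I.

(** When [T i0] is the shift along the i-th lattice generator, this is multiplication by z_i - 1. *)
Definition diffop (x : E) : E := T i0 x - x.

Lemma diffop_linear k a x y :
  iter k diffop (a *: x + y) = a *: iter k diffop x + iter k diffop y.
Proof.
elim: k => //= k ->; rewrite /diffop linearP scalerBr opprD.
by rewrite addrACA.
Qed.

Lemma diffop_comm k i x : iter k diffop (T i x) = T i (iter k diffop x).
Proof. by elim: k => //= k ->; rewrite /diffop Tcomm linearB. Qed.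

Lemma diffop_submod W k : submod Tf W -> submod Tf [set x | W (iter k diffop x)].
Proof.
move=> sW; split => /=.
- have /= -> : iter k diffop 0 = 0 by elim: k => //= k ->; rewrite /diffop linear0 subr0.
  by case: sW.
- by move=> a x y hx hy; rewrite diffop_linear; case: sW => _ h _; apply: h.
- by move=> i x hx; rewrite diffop_comm; case: sW => _ _ h; apply: h.
Qed.

Lemma diffop_stable W k x : submod Tf W -> W x -> W (iter k diffop x).
Proof.
move=> sW Wx; elim: k => //= k IH; apply: (submodB sW) => //.
by case: sW => _ _ h; apply: h.
Qed.

Section Maximal.
Variable W : set E.
Hypothesis sW : submod Tf W.
Hypothesis nW : ~ (exists k, forall j, W (iter k diffop (e j))).
Hypothesis maxW : forall V, submod Tf V -> W `<=` V ->
  ~ (exists k, forall j, V (iter k diffop (e j))) -> V `<=` W.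

(** Schur's lemma up to powers of [diffop]. The submodules [W] + im f and f^(-1)([W]) both contain
    [W], so each lies in [W] or contains the image of the generators under some power of [diffop].
    If both did the latter, the two powers would compose to one mapping all generators into [W],
    which is excluded. *)
Lemma maximal_dichotomy (f : E -> E) :
  (forall a x y, f (a *: x + y) = a *: f x + f y) ->
  (forall i x, f (T i x) = T i (f x)) ->
  (forall x, W x -> W (f x)) ->
  (forall x, W (f x)) \/
  ((forall x, W (f x) -> W x) /\
   exists k, forall x, exists y, W (iter k diffop x - f y)).
Proof.
move=> fl fT fW.
have f0 : f 0 = 0 by have := fl (-1) 0 0; rewrite scaleN1r oppr0 addr0 scaleN1r addNr.
have fdiff k x : f (iter k diffop x) = iter k diffop (f x).
  elim: k => //= k IH; rewrite -IH /diffop addrC -scaleN1r fl fT scaleN1r.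
  by rewrite addrC.
pose V1 := [set x | exists y, W (x - f y)].
have sV1 : submod Tf V1.
  split.
  - by exists 0; rewrite f0 subr0; case: sW.
  - move=> a x y [x' hx] [y' hy]; exists (a *: x' + y').
    by rewrite fl opprD addrACA -scalerBr; case: sW => _ h _; apply: h.
  - move=> i x [y hy]; exists (T i y); rewrite fT -linearB.
    by case: sW => _ _ h; apply: h.
pose V2 := [set x | W (f x)].
have sV2 : submod Tf V2.
  split; rewrite /V2 /=.
  - by rewrite f0; case: sW.
  - by move=> a x y hx hy; rewrite fl; case: sW => _ h _; apply: h.
  - by move=> i x hx; rewrite fT; case: sW => _ _ h; apply: h.
have WV1 : W `<=` V1 by move=> x Wx; exists 0; rewrite f0 subr0.
have [[k hk]|n1] := pselect (exists k, forall j, V1 (iter k diffop (e j))); last first.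
  left => x; apply: (maxW sV1 WV1 n1); exists x; rewrite subrr; by case: sW.
have {}hk x : V1 (iter k diffop x) by apply: (egen (diffop_submod k sV1)).
right; split; last by exists k.
have [[l hl]|n2] := pselect (exists k, forall j, V2 (iter k diffop (e j))); last first.
  by move=> x; apply: (maxW sV2 fW n2).
have {}hl x : V2 (iter l diffop x) by apply: (egen (diffop_submod l sV2)).
case: nW; exists (l + k)%N => j; rewrite iterD; have [y hy] := hk (e j).
rewrite -(subrK (f y) (iter k diffop (e j))) -[_ - _]scale1r diffop_linear scale1r.
by apply: (submodD sW); [apply: diffop_stable|rewrite -fdiff; apply: hl].
Qed.

(** The field is algebraically closed, so [p] splits into linear factors, each of them injective
    modulo [W]. *)
Lemma maximal_pact_inj i (p : {poly C}) x :
  (forall c y, W (T i y - c *: y) -> W y) -> p != 0 -> W (pact (T i) p x) -> W x.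
Proof.
move=> inj; move: {-1}(size p) (leqnn (size p)) => N.
elim: N p x => [|N IH] p x; first by rewrite leqn0 size_poly_eq0 => ->.
move=> sp p0; have [/size_poly1P[c c0 ->]|s1] := boolP (size p == 1%N).
  rewrite /pact size_polyC c0 big_ord_recl big_ord0 addr0 coefC eqxx /= => h.
  by have := submodZ c^-1 sW h; rewrite scalerA mulVf // scale1r.
have [c /factor_theorem[q pq]] := closed_rootP p s1.
have q0 : q != 0 by apply: contraNneq p0 => q0; rewrite pq q0 mul0r.
rewrite pq pact_mulXsub => h; apply: (inj c); apply: (IH q) => //.
by move: sp; rewrite pq size_Mmonic ?monicXsubC // size_XsubC addn2 /=.
Qed.

Lemma pact_stable i (p : {poly C}) x : W x -> W (pact (T i) p x).
Proof.
move=> Wx; apply: (submod_sum _ sW) => j; apply: (submodZ _ sW).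
by elim: (nat_of_ord j) => //= k IH; case: sW => _ _ h; apply: h.
Qed.

(* Otherwise each resolvent [(T i - c)^-1] applied to a fixed vector stays, mod W,
   in a space of countable dimension, so uncountably many of them cannot be
   linearly independent. *)
Lemma maximal_eigen i : exists c, forall x, W (T i x - c *: x).
Proof.
apply: contrapT => /forallNP nc.
have dich0 j c : (forall x, W (T j x - c *: x)) \/
   ((forall x, W (T j x - c *: x) -> W x) /\
    exists k, forall x, exists y, W (iter k diffop x - (T j y - c *: y))).
  apply: (@maximal_dichotomy (fun x => T j x - c *: x)).
  - move=> a x y; rewrite linearP scalerDr opprD addrACA scalerBr !scalerA.
    by rewrite [c * a]mulrC.
  - by move=> l x; rewrite Tcomm linearB linearZ_LR.
  - move=> x Wx; apply: (submodB sW); last exact: (submodZ _ sW).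
    by case: sW => _ _ h; apply: h.
have dich c : (forall x, W (T i x - c *: x) -> W x) /\
   exists k, forall x, exists y, W (iter k diffop x - (T i y - c *: y)).
  by have [/nc|] := dich0 i c.
have inj c y := (dich c).1 y.
have [x0 nx0] : exists x, ~ W x.
  by apply: contrapT => /forallNP h; apply: nW; exists 0%N => j; apply: contrapT (h _).
(* This is the dichotomy for [T i0] and the scalar 1, whose first alternative would put the
   differences of all generators into [W]. *)
have sinj k x : W (iter k diffop x) -> W x.
  have [h|[h _]] := dich0 i0 1.
    by case: nW; exists 1%N => j /=; have := h (e j); rewrite scale1r.
  by elim: k => //= k IH h'; apply: IH; apply: h; rewrite scale1r.
(* For each real [c] the equation ([T i] - c) y = [diffop]^k x0 is solvable modulo [W]; the pair
   records the power and how many spanning vectors [y] needs. *)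
have data (c : R) : exists kN : nat * nat, exists y (v : 'rV[C]_kN.2),
    W (iter kN.1 diffop x0 - (T i y - (toC c) *: y)) /\ y = \sum_(l < kN.2) v 0 l *: b l.
  have [_ [k hk]] := dich (toC c); have [y hy] := hk x0.
  by have [N [v yv]] := bspan y; exists (k, N), y, v.
have [kN kNP] := choice data.
(* Pairs of naturals are countable, so infinitely many scalars share one pair. *)
have [q qinf] := real_infinite_fiber (fun c => choice.pickle (kN c)).
have [[k N] kq] : exists p : nat * nat, forall c, choice.pickle (kN c) = q -> kN c = p.
  have [[c hc]|hn] := pselect (exists c, choice.pickle (kN c) = q).
    by exists (kN c) => c' hc'; apply: (pcan_inj choice.pickleK); rewrite hc hc'.
  by exists (0%N, 0%N) => c hc; case: hn; exists c.
(* N + 1 scalars whose solutions lie in the span of N vectors: these solutions satisfy a linear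
   relation, with coefficients [w] below. *)
have [B Bsub Bcard] := infinite_set_fset N.+1 qinf.
pose s := take N.+1 (enum_fset B).
have us : uniq s by rewrite take_uniq.
have ss : size s = N.+1 by rewrite size_take_min; apply/minn_idPl.
pose mu (l : 'I_N.+1) : C := toC (nth 0 s l).
have muinj : injective mu.
  move=> l l' /(@complexI R) /eqP; rewrite nth_uniq ?ss // => /eqP; exact: val_inj.
have dat (l : 'I_N.+1) : exists v : 'rV[C]_N,
    W (iter k diffop x0 - (T i (\sum_(h < N) v 0 h *: b h)
        - mu l *: (\sum_(h < N) v 0 h *: b h))).
  have hB : nth 0 s l \in B by apply: (mem_take (n0 := N.+1)); apply: mem_nth; rewrite ss.
  have := kNP (nth 0 s l); rewrite (kq _ (Bsub _ hB)) => -[y [v [h yv]]].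
  by exists v; rewrite -yv.
have [v vP] := choice dat.
pose A := \matrix_(l < N.+1) v l.
have [w w0 wA] : exists2 w : 'rV[C]_N.+1, w != 0 & w *m A = 0.
  have : kermx A != 0 by rewrite kermx_eq0 /row_free neq_ltn ltnS rank_leq_col.
  by case/rowV0Pn => w /sub_kermxP wA w0; exists w.
pose y l := \sum_(h < N) v l 0 h *: b h.
have wy : \sum_l w 0 l *: y l = 0.
  under eq_bigr => l _ do rewrite scaler_sumr.
  rewrite exchange_big big1 //= => h _; under eq_bigr => l _ do rewrite scalerA.
  rewrite -scaler_suml; have := congr1 (fun M : 'rV_N => M 0 h) wA.
  rewrite !mxE => z; rewrite (eq_bigr (fun l => w 0 l * A l h)) ?z ?scale0r //.
  by move=> l _; rewrite mxE.
(* Modulo [W], g(T) sends [diffop]^k x0 to P(T) applied to the vanishing sum of the [w 0 l *: y l].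
   But g is nonzero: at [mu l] with [w 0 l] nonzero only the term of [Q l] survives. Injectivity
   then puts [x0] into [W]. *)
pose P := \prod_l ('X - (mu l)%:P).
pose Q l := \prod_(l' | l' != l) ('X - (mu l')%:P).
have PQ l : P = Q l * ('X - (mu l)%:P) by rewrite /P (bigD1 l) //= mulrC.
pose g := \sum_l w 0 l *: Q l.
apply: nx0; apply: (sinj k); apply: (@maximal_pact_inj i g _ inj).
  have /rV0Pn[l wl] := w0; apply/eqP => /(congr1 (horner^~ (mu l))).
  rewrite horner_sum (bigD1 l) //= big1 => [|l' l'l].
    rewrite horner0 addr0 hornerZ => /eqP; rewrite mulf_eq0 (negPf wl) /= horner_prod.
    apply/negP/prodf_neq0 => l' l'l; rewrite hornerXsubC subr_eq0.
    by apply: contra l'l => /eqP/muinj ->.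
  rewrite hornerZ horner_prod (bigD1 l) 1?eq_sym //= hornerXsubC subrr.
  by rewrite mul0r mulr0.
have h0 : pact (T i) P (\sum_l w 0 l *: y l) = 0.
  have := pact_linear (T i) P (-1) 0 0.
  by rewrite wy scaler0 addr0 scaleN1r addNr.
suff : W (pact (T i) g (iter k diffop x0) - pact (T i) P (\sum_l w 0 l *: y l)).
  by rewrite h0 subr0.
have -> : pact (T i) P (\sum_l w 0 l *: y l) = \sum_l w 0 l *: pact (T i) P (y l).
  elim: (index_enum _) => [|l t IH]; last by rewrite !big_cons pact_linear IH.
  by rewrite !big_nil; move: h0; rewrite wy.
rewrite pact_sum -sumrB; apply: (submod_sum _ sW) => l.
rewrite pactZ -scalerBr; apply: (submodZ _ sW).
rewrite (PQ l) pact_mulXsub addrC -scaleN1r -pact_linear scaleN1r [- _ + _]addrC.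
apply: pact_stable; exact: vP.
Qed.

End Maximal.

(** Failing nilpotency, take [W] maximal over [M]. All operators are scalar on the quotient by [W],
    so any nonzero functional vanishing on [W] is a common eigenvector; the eigenvalue 1 for [T i0]
    would put the differences of the generators into [W]. *)
Lemma nilpotent_or_character (M : set E) : submod Tf M ->
  (exists k, forall x, M (iter k diffop x)) \/
  exists (phi : E -> C) (chi : I -> C),
    [/\ forall a x y, phi (a *: x + y) = a * phi x + phi y,
        forall x, M x -> phi x = 0, exists x, phi x != 0,
        forall i x, phi (T i x) = chi i * phi x & chi i0 != 1].
Proof.
move=> sM; have [[k hk]|nM] := pselect (exists k, forall j, M (iter k diffop (e j))).
  by left; exists k; apply: (egen (diffop_submod k sM)).
right; have [W [sW MW nW maxW]] := exists_maximal_submod sM nM.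
have [chi chiP] := choice (maximal_eigen sW nW maxW).
have [p np] : exists x, ~ W x.
  by apply: contrapT => /forallNP h; apply: nW; exists 0%N => j; apply: contrapT (h _).
have [phi [phil phiW phip]] := separating_functional sW np.
exists phi, chi; split => //.
- by move=> x /MW/phiW.
- by exists p; rewrite phip oner_neq0.
- move=> i x; have := phiW _ (chiP i x); rewrite addrC -scaleNr phil mulNr.
  by move/eqP; rewrite addrC subr_eq0 => /eqP.
- apply/eqP => c1; apply: nW; exists 1%N => j /=.
  by have := chiP i0 (e j); rewrite c1 scale1r.
Qed.

End Nullstellensatz.

(** * Free modules over a field *)

Section FreeModule.
Variables (F : fieldType) (K : choiceType).
Local Notation E := {malg F[K]}.

Lemma malg_scaleU a (k : K) : << a *g k >> = a *: << k >> :> E.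
Proof. by apply/malgP => k'; rewrite mcoeffZ !mcoeffU mulrnAr mulr1. Qed.

Lemma malg_sumU (x : E) : x = \sum_(k <- msupp x) x@_k *: << k >>.
Proof. by rewrite {1}[x]monalgE; apply: eq_bigr => k _; rewrite malg_scaleU. Qed.

Section Extension.
Variables (V : lmodType F) (f : K -> V).

Definition lext (x : E) : V := \sum_(k <- msupp x) x@_k *: f k.

Lemma lextEw (D : {fset K}) x : (msupp x `<=` D)%fset ->
  lext x = \sum_(k <- D) x@_k *: f k.
Proof.
move=> le; rewrite /lext (big_fset_incl _ le) => //= k _ /mcoeff_outdom ->.
by rewrite scale0r.
Qed.

Lemma lext_is_linear : linear lext.
Proof.
move=> a x y; pose D := (msupp x `|` msupp y)%fset.
have Dx : (msupp x `<=` D)%fset by apply: fsubsetUl.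
have Dy : (msupp y `<=` D)%fset by apply: fsubsetUr.
have Dxy : (msupp (a *: x + y) `<=` D)%fset.
  apply: (fsubset_trans (msuppD_le _ _)); apply: fsetUSS => //.
  exact: msuppZ_le.
rewrite (lextEw Dx) (lextEw Dy) (lextEw Dxy) scaler_sumr -big_split.
by apply: eq_bigr => k _; rewrite mcoeffD mcoeffZ scalerDl scalerA.
Qed.

HB.instance Definition _ := GRing.isLinear.Build F E V *:%R lext lext_is_linear.

Lemma lextU k : lext << k >> = f k.
Proof. by rewrite (lextEw msuppU_le) big_seq_fset1 mcoeffUU scale1r. Qed.

Lemma lext_unique (g : E -> V) :
  (forall a x y, g (a *: x + y) = a *: g x + g y) ->
  (forall k, g << k >> = f k) -> forall x, g x = lext x.
Proof.
move=> gl gU x; rewrite /lext {1}[x]malg_sumU.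
elim: (enum_fset _) => [|k s IH]; last by rewrite !big_cons gl gU IH.
have := gl (-1) 0 0; rewrite !big_nil scaler0 addr0 scaleN1r => ->.
by rewrite addNr.
Qed.

End Extension.
End FreeModule.

Lemma malg_countable_span (F : fieldType) (K : countType) :
  exists b : nat -> {malg F[K]}, forall x, exists N (c : 'rV[F]_N),
    x = \sum_(i < N) c 0 i *: b i.
Proof.
(* Position i carries the basis vector whose code is i, or 0 if i codes no key; [N] below exceeds
   every code in the support. *)
exists (fun i => oapp (fun k => << k >>) 0 (choice.pickle_inv i)) => x.
pose N := (\max_(k <- msupp x) choice.pickle k).+1.
exists N, (\row_i oapp (fun k => x@_k) 0 (choice.pickle_inv (i : nat) : option K)).
apply/malgP => k; rewrite raddf_sum /=.
have term (i : 'I_N) : ((\row_(i < N) oapp (fun k => x@_k) 0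
    (choice.pickle_inv (i : nat) : option K)) 0 i *: oapp (fun k : K => << k >>) 0
    (choice.pickle_inv (i : nat)))@_k = x@_k *+ (choice.pickle k == i).
  rewrite mcoeffZ mxE; case e : choice.pickle_inv => [k'|] /=.
    have {}e : choice.pickle k' = i :> nat.
      by have := choice.pickle_invK (T := K) i; rewrite /ocancel e /=.
    rewrite mcoeffU -e (inj_eq (pcan_inj choice.pickleK)) [k == _]eq_sym.
    by case: eqP => [->|_]; rewrite ?mulr1 ?mulr0.
  rewrite mul0r; case: eqP => // kk; move: e; rewrite -kk.
  by rewrite choice.pickleK_inv.
rewrite (eq_bigr _ (fun i _ => term i)).
have [kx|/mcoeff_outdom ->] := boolP (k \in msupp x); last first.
  by rewrite big1 // => i _; rewrite mul0rn.
have kN : (choice.pickle k < N)%N by rewrite ltnS; apply: leq_bigmax_seq.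
rewrite (bigD1 (Ordinal kN)) //= eqxx big1 ?addr0 // => i; rewrite -val_eqE /=.
by rewrite eq_sym => /negPf ->.
Qed.

(** * Velocity fields as functionals on Laurent vectors *)

Section Fields.
Variables (R : realType) (d n m : nat).
Local Notation C := (complex R).
Local Notation vfield := (vfield R d n).
Local Notation K := ('rV[int]_d * 'I_(n * d))%type.
Local Notation E := {malg C[K]}.

(** [E] is C(z)^(dn), seen as the free space on pairs of an exponent and a coordinate. Its algebraic
    dual is the space of all velocity fields, with [field_of] as the inverse construction. Exponent
    k meets u(k) without a sign; [lelt] supplies the sign of the convention in [lpair]. *)
Definition pair (u : vfield) (x : E) : C :=
  lext (fun k => mxvec (u k.1) 0 k.2 : C^o) x.

Lemma pairP u a x y : pair u (a *: x + y) = a * pair u x + pair u y.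
Proof. by rewrite /pair linearP. Qed.

Lemma pairZ u a x : pair u (a *: x) = a * pair u x.
Proof. exact: linearZ_LR. Qed.

Lemma pairB u x y : pair u (x - y) = pair u x - pair u y.
Proof. exact: linearB. Qed.

Lemma pair_sum u (T : Type) (s : seq T) (f : T -> E) :
  pair u (\sum_(t <- s) f t) = \sum_(t <- s) pair u (f t).
Proof. exact: linear_sum. Qed.

Lemma pairU u k v i : pair u << (k, mxvec_index v i) >> = u k v i.
Proof. by rewrite /pair lextU mxvecE. Qed.

Definition shift (a : 'rV[int]_d) (x : E) : E :=
  lext (fun k => << (k.1 + a, k.2) >>) x.

HB.instance Definition _ a := GRing.Linear.copy (shift a) (@lext C K E _).

Lemma shiftP a c x y : shift a (c *: x + y) = c *: shift a x + shift a y.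
Proof. exact: linearP. Qed.

Lemma shiftU a k : shift a << k >> = << (k.1 + a, k.2) >>.
Proof. exact: lextU. Qed.

Definition translate (a : 'rV[int]_d) (u : vfield) : vfield := fun k => u (k + a).

Lemma pair_shift u a x : pair u (shift a x) = pair (translate a u) x.
Proof.
apply: (lext_unique (f := fun k => _ : C^o) (g := fun x => pair u (shift a x) : C^o)).
  by move=> c y z; rewrite linearP pairP.
by move=> k; rewrite shiftU /pair lextU.
Qed.

Lemma shift_comm a c x : shift a (shift c x) = shift c (shift a x).
Proof.
suff h a' c' y : shift a' (shift c' y) = lext (fun k => << (k.1 + c' + a', k.2) >>) y.
  rewrite !h; apply: lext_unique => [b y z|k]; first exact: linearP.
  by rewrite lextU addrAC.
apply: (lext_unique (g := fun y => shift a' (shift c' y))).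
  by move=> b z t; rewrite (shiftP c' b z t) (shiftP a' b).
by move=> k; rewrite !shiftU.
Qed.

Definition field_of (phi : E -> C) : vfield := fun k =>
  \matrix_(v, i) phi << (k, mxvec_index v i) >>.

Lemma field_ofE phi k v i : field_of phi k v i = phi << (k, mxvec_index v i) >>.
Proof. exact: mxE. Qed.

Lemma field_of_shift phi (chi : 'rV[int]_d -> C) :
  (forall a x, phi (shift a x) = chi a * phi x) ->
  forall k a, field_of phi (k + a) = chi a *: field_of phi k.
Proof.
move=> h k a; apply/matrixP => v i; apply: (etrans (field_ofE _ _ _ _)).
have := h a << (k, mxvec_index v i) >>; rewrite shiftU => e; apply: (etrans e).
by rewrite -(field_ofE phi k v i) [RHS]mxE.
Qed.

Lemma pair_field_of phi x :
  (forall a x y, phi (a *: x + y) = a * phi x + phi y) ->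
  pair (field_of phi) x = phi x.
Proof.
move=> phil; have -> : phi x = lext (fun k => phi << k >> : C^o) x.
  exact: (lext_unique (g := phi : E -> C^o)).
rewrite /pair; congr lext; apply: funext => -[k j] /=.
by case: (mxvec_indexP j) => v i; rewrite mxvecE mxE.
Qed.

Lemma shift_generators (W : set E) : submod (fun a => shift a : E -> E) W ->
  (forall j, W << (0, j) >>) -> forall x, W x.
Proof.
move=> sW h x; rewrite [x]malg_sumU; apply: (submod_sum _ sW) => -[k j].
apply: (submodZ _ sW); have := h j; case: sW => _ _ hs /(hs k).
by rewrite shiftU /= add0r.
Qed.

End Fields.

(** * Flex equations and rigid motions *)

Section Flexes.
Variables (R : realType) (d n m : nat) (X : crystal R d n m).
Local Notation C := (complex R).
Local Notation vfield := (vfield R d n).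
Implicit Types (u : vfield) (k l : 'rV[int]_d).

HB.instance Definition _ := GRing.RMorphism.copy (@toC R) (real_complex R).

Definition perC : 'M[C]_d := map_mx (@toC R) (cper X).
Definition posC (v : 'I_n) : 'rV[C]_d := map_mx (@toC R) (cpos X v).

Lemma toC_intv k : map_mx (@toC R) (intv R k) = intvC R k.
Proof. by apply/matrixP => i j; rewrite !mxE rmorph_int. Qed.

Lemma intvCD k l : intvC R (k + l) = intvC R k + intvC R l.
Proof. by apply/matrixP => i j; rewrite !mxE intrD. Qed.

Lemma intvC0 : intvC R (0 : 'rV[int]_d) = 0.
Proof. by apply/matrixP => i j; rewrite !mxE. Qed.

Lemma intvC_delta i : intvC R (delta_mx 0 i : 'rV[int]_d) = delta_mx 0 i.
Proof. by apply/matrixP => y z; rewrite !mxE; case: (_ && _). Qed.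

Lemma placeCE v k : placeC X (v, k) = posC v + intvC R k *m perC.
Proof. by rewrite /placeC /place map_mxD map_mxM toC_intv. Qed.

Lemma peCE e : peC X e =
  placeC X (esrc X e, eshk X e) - placeC X (etgt X e, eshl X e).
Proof. by rewrite /peC /pe map_mxB. Qed.

Lemma placeC_ends e k : placeC X (esrc X e, eshk X e + k) -
  placeC X (etgt X e, eshl X e + k) = peC X e.
Proof. by rewrite peCE !placeCE !intvCD !mulmxDl !addrA opprD addrACA subrr addr0. Qed.

(** The flex equation of the k-th translate of motif edge [e], whose edge vector p(e) does not
    depend on k. *)
Definition edge_form u e k : C :=
  \sum_i (u (eshk X e + k) (esrc X e) i - u (eshl X e + k) (etgt X e) i) * peC X e 0 i.

Lemma edge_formE u e k : edge_form u e k =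
  dotC (vel u (esrc X e, eshk X e + k) - vel u (etgt X e, eshl X e + k)) (peC X e).
Proof. by rewrite /dotC mxE; apply: eq_bigr => i _; rewrite /vel !mxE. Qed.

Lemma flexP u : is_flex X u <-> forall e k, edge_form u e k = 0.
Proof.
split => [h e k|h x y [e [k ends_xy]]].
  by rewrite edge_formE -(placeC_ends e k); apply: h; exists e, k; left.
have := h e k; rewrite edge_formE -(placeC_ends e k) => hek.
case: ends_xy; rewrite /ends => -[<- <-] //.
rewrite -opprB -[placeC _ _ - _]opprB /dotC linearN mulNmx mulmxN opprK.
exact: hek.
Qed.

(** Placements are row vectors here, so [S] is the transpose of the matrix in [rigid_flex]. *)
Definition affine (S : 'M[C]_d) (b : 'rV[C]_d) : vfield :=
  fun k => \matrix_v (placeC X (v, k) *m S + b).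

Lemma rigid_flexE (S : 'M[R]_d) (b : 'rV[R]_d) k :
  rigid_flex X S b k = affine (map_mx (@toC R) S^T) (map_mx (@toC R) b) k.
Proof.
apply/matrixP => v i; rewrite mxE map_mxD map_mxM.
by rewrite [RHS]mxE.
Qed.

Lemma affineP a (S S' : 'M[C]_d) (b b' : 'rV[C]_d) k :
  affine (a *: S + S') (a *: b + b') k = a *: affine S b k + affine S' b' k.
Proof.
apply/row_matrixP => v; rewrite linearP /= !rowK mulmxDr -scalemxAr scalerDr.
by rewrite addrACA.
Qed.

Lemma affine0 k : affine 0 0 k = 0.
Proof. by apply/row_matrixP => v; rewrite rowK mulmx0 addr0 row0. Qed.

(** Splitting a complex skew matrix and a complex translation into real and imaginary parts shows
    that the complex span of the real rigid motions consists of single complex ones. *)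
Lemma FrigP u : in_Frig X u <->
  exists S b, S^T = - S /\ forall k, u k = affine S b k.
Proof.
split.
  case=> s [sS us].
  suff [S [b [SS Sb]]] : exists S b, S^T = - S /\ forall k,
      \sum_(t <- s) t.1.1 *: rigid_flex X t.1.2 t.2 k = affine S b k.
    by exists S, b; split => // k; rewrite us.
  elim: s sS {us} => [|[[c S1] b1] s IH] sS.
    by exists 0, 0; rewrite trmx0 oppr0; split => // k; rewrite big_nil affine0.
  have [t ts|S [b [SS Sb]]] := IH; first by apply: sS; right.
  have S1S : S1^T = - S1 := sS (c, S1, b1) (or_introl erefl).
  exists (c *: map_mx (@toC R) S1^T + S), (c *: map_mx (@toC R) b1 + b); split.
    have hm : (map_mx (@toC R) S1^T)^T = - map_mx (@toC R) S1^T.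
      by rewrite map_trmx trmxK S1S map_mxN opprK.
    by rewrite linearP /= SS hm scalerN opprD.
  by move=> k; rewrite big_cons Sb affineP rigid_flexE.
case=> S [b [SS Sb]].
pose reM p q (A : 'M[C]_(p, q)) := map_mx (@complex.Re R) A.
pose imM p q (A : 'M[C]_(p, q)) := map_mx (@complex.Im R) A.
have dec p q (A : 'M[C]_(p, q)) :
    A = 'i%C *: map_mx (@toC R) (imM _ _ A) + map_mx (@toC R) (reM _ _ A).
  by apply/matrixP => i j; rewrite !mxE addrC mulrC [LHS]complexE mulrC.
exists [:: ('i%C, (imM _ _ S)^T, imM _ _ b); (1, (reM _ _ S)^T, reM _ _ b)]; split.
  have skew i j : S j i = - S i j.
    by have := congr1 (fun M : 'M_d => M i j) SS; rewrite !mxE.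
  move=> t /= [<-|[<-|//]] /=; rewrite trmxK; apply/matrixP => i j; rewrite !mxE.
    by rewrite (skew i j); case: (S i j) => ? ? /=; rewrite opprK.
  by rewrite (skew i j); case: (S i j) => ? ? /=; rewrite opprK.
move=> k; rewrite Sb !big_cons big_nil addr0 scale1r !rigid_flexE /= !trmxK.
by rewrite -affineP -!dec.
Qed.

Lemma skew_form0 (S : 'M[C]_d) (a : 'rV[C]_d) : S^T = - S -> (a *m S *m a^T) 0 0 = 0.
Proof.
move=> SS; set q := a *m S *m a^T.
have : q^T = - q.
  by rewrite /q !trmx_mul trmxK SS mulNmx mulmxN mulmxA.
move/(congr1 (fun M : 'M_1 => M 0 0)); rewrite !mxE => /eqP.
by rewrite -addr_eq0 -mulr2n mulrn_eq0 => /eqP.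
Qed.

(** The velocities at the ends of an edge differ by p(e)S, and p(e)S is orthogonal to p(e) for skew
    [S]. *)
Lemma Frig_flex u : in_Frig X u -> is_flex X u.
Proof.
move=> /FrigP[S [b [SS ub]]]; apply/flexP => e k; rewrite edge_formE.
rewrite /vel /= !ub !rowK opprD addrACA subrr addr0 -mulmxBl placeC_ends.
exact: skew_form0.
Qed.

(** Common form of rigid motions and flexible lattice fields; such fields are exponential, with
    multi-factor 1 and polynomials of degree at most one. *)
Definition lattice_affine u := exists A (B : 'I_d -> 'M[C]_(n, d)),
  forall k, u k = A + \sum_j (k 0 j)%:~R *: B j.

Lemma lattice_affine_Vexp u : lattice_affine u -> in_Vexp u.
Proof.
case=> A [B uAB].
exists ((const_mx 1, mpoly.mpolyC d 1, A) ::
  [seq (const_mx 1, mpoly.mpolyX C (mpoly.mnm1 j), B j) | j <- index_enum 'I_d]).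
have z1 k : zpow (const_mx 1 : 'rV[C]_d) k = 1.
  by rewrite /zpow big1 // => i _; rewrite mxE exp1rz.
split.
  have nz1 : nonzero_entries (const_mx 1 : 'rV[C]_d).
    by move=> i; rewrite mxE oner_neq0.
  move=> t /= [<- //|]; elim: (index_enum 'I_d) => //= j s IH [<- //|/IH //].
move=> k; rewrite uAB big_cons /= mpoly.mevalC z1 mulr1 scale1r big_map; congr (_ + _).
by apply: eq_bigr => j _; rewrite /= z1 mulr1 mpoly.mevalXU.
Qed.

Lemma factor_periodic_Vexp w u : nonzero_entries w ->
  (forall k, u k = zpow w k *: u 0) -> in_Vexp u.
Proof.
move=> w0 uw; exists [:: (w, mpoly.mpolyC d 1, u 0)]; split; first by move=> t [<-|].
by move=> k; rewrite big_cons big_nil addr0 /= mpoly.mevalC mul1r.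
Qed.

Lemma mulmx_intvC k (Y : 'M[C]_d) : intvC R k *m Y = \sum_j (k 0 j)%:~R *: row j Y.
Proof. by rewrite mulmx_sum_row; apply: eq_bigr => j _; rewrite mxE. Qed.

Lemma affine_lattice S b : lattice_affine (affine S b).
Proof.
exists (affine S b 0), (fun j => \matrix_v row j (perC *m S)) => k.
apply/row_matrixP => v; rewrite linearD linear_sum /= !rowK !placeCE.
rewrite intvC0 mul0mx addr0 mulmxDl addrAC -mulmxA mulmx_intvC; congr (_ + _).
by apply: eq_bigr => j _; rewrite linearZ /= rowK.
Qed.

Lemma flexible_lattice_affine u : flexible_lattice_periodic_flex X u -> lattice_affine u.
Proof.
case=> _ [Y uY]; exists (u 0), (fun j => \matrix_v row j Y^T) => k.
rewrite uY; congr (_ + _); apply/matrixP => v i; rewrite mxE mulmx_intvC.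
rewrite !summxE; apply: eq_bigr => j _; by rewrite !mxE.
Qed.

Lemma first_order_exp_rigid : first_order_rigid X -> exp_rigid X.
Proof.
move=> h u; split=> [[_ /h] //|Fu]; split; last exact/h.
have /FrigP[S [b [_ ub]]] := Fu.
by have [A [B AB]] := affine_lattice S b; apply: lattice_affine_Vexp; exists A, B => k; rewrite ub.
Qed.

Lemma exp_rigid_no_periodic : exp_rigid X -> no_nontrivial_periodic_flexes X.
Proof.
move=> h; split=> [w u w0 [uf uw]|u fu]; apply/h; split => //.
- exact: factor_periodic_Vexp uw.
- exact/lattice_affine_Vexp/flexible_lattice_affine.
- by case: fu.
Qed.

End Flexes.

(** Solves recurrences along the generators: it is applied to a field divided, or diminished, by the
    expected solution. *)
Lemma lattice_invariant (V : Type) d (g : 'rV[int]_d -> V) :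
  (forall k j, g (k + delta_mx 0 j) = g k) -> forall k, g k = g 0.
Proof.
move=> gi k; rewrite [k]row_sum_delta.
have gs (c : int) j y : g (c *: delta_mx 0 j + y) = g y.
  elim/int_rec: c => [|N IH|N IH]; first by rewrite scale0r add0r.
    by rewrite intS scalerDl scale1r -addrA addrC gi.
  by rewrite -(gi _ j) -[RHS]IH intS opprD scalerDl scaleN1r -[- _ + _ + y]addrA [_ + delta_mx _ _]addrC addNKr.
by elim: (index_enum _) => [|j s IH]; rewrite ?big_nil // big_cons gs.
Qed.

(** * Multi-factors, translations and differences *)

Section NilpotentFlexes.
Variables (R : realType) (d n m : nat) (X : crystal R d n m).
Local Notation C := (complex R).
Local Notation vfield := (vfield R d n).
Local Notation K := ('rV[int]_d * 'I_(n * d))%type.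
Local Notation E := {malg C[K]}.
Implicit Types (u : vfield) (k l : 'rV[int]_d).

Lemma zpow0 (w : 'rV[C]_d) : zpow w 0 = 1.
Proof. by rewrite /zpow big1 // => i _; rewrite mxE expr0z. Qed.

Lemma zpowD (w : 'rV[C]_d) k l : nonzero_entries w ->
  zpow w (k + l) = zpow w k * zpow w l.
Proof.
by move=> w0; rewrite /zpow -big_split; apply: eq_bigr => i _; rewrite mxE expfzDr.
Qed.

Lemma zpow_delta (w : 'rV[C]_d) i : zpow w (delta_mx 0 i) = w 0 i.
Proof.
rewrite /zpow (bigD1 i) //= big1 => [|j ji]; first by rewrite mxE !eqxx expr1z mulr1.
by rewrite mxE eqxx (negPf ji) expr0z.
Qed.

Lemma zpow_neq0 (w : 'rV[C]_d) k : nonzero_entries w -> zpow w k != 0.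
Proof. by move=> w0; apply/prodf_neq0 => i _; rewrite expfz_neq0. Qed.

Lemma factor_periodic_steps (w : 'rV[C]_d) u : nonzero_entries w ->
  (forall k j, u (k + delta_mx 0 j) = w 0 j *: u k) -> forall k, u k = zpow w k *: u 0.
Proof.
move=> w0 h k.
have -> : u 0 = (zpow w k)^-1 *: u k; last first.
  by rewrite scalerA mulfV ?zpow_neq0 // scale1r.
rewrite (@lattice_invariant _ d (fun k => (zpow w k)^-1 *: u k)).
  by rewrite zpow0 invr1 scale1r.
move=> {}k j /=; rewrite h zpowD // zpow_delta scalerA invfM.
by rewrite -mulrA mulVf ?w0 // mulr1.
Qed.

(** A rigid motion is affine in k, so its second difference along a direction i with w_i different
    from 1 vanishes, while factor-periodicity makes that difference (w_i - 1)^2 u(0). *)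
Lemma factor_periodic_Frig0 (w : 'rV[C]_d) u : nonzero_entries w -> w != const_mx 1 ->
  (forall k, u k = zpow w k *: u 0) -> in_Frig X u -> forall k, u k = 0.
Proof.
move=> w0 w1 uw /FrigP[S [b [_ ub]]].
have [i wi] : exists i, w 0 i != 1.
  apply: contrapT => /forallNP h; case/eqP: w1; apply/rowP => i; rewrite mxE.
  by apply/eqP/negPn/negP/(h i).
have second : u (delta_mx 0 i + delta_mx 0 i) - u (delta_mx 0 i) = u (delta_mx 0 i) - u 0.
  apply/row_matrixP => v; rewrite !linearB /= !ub !rowK !placeCE intvCD intvC0.
  rewrite !mulmxDl !mul0mx addr0.
  move: (posC X v *m S) (_ *m _ *m S) => P Q; apply/rowP => c; rewrite !mxE; ring.
suff u0 : u 0 = 0 by move=> k; rewrite uw u0 scaler0.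
have := second; rewrite (uw (_ + _)) (uw (delta_mx 0 i)) zpowD // zpow_delta => /eqP.
rewrite -subr_eq0 -{4}[u 0]scale1r -!scalerBl scaler_eq0.
have -> : w 0 i * w 0 i - w 0 i - (w 0 i - 1) = (w 0 i - 1) ^+ 2 by ring.
by rewrite expf_eq0 subr_eq0 (negPf wi) /= => /eqP.
Qed.

(** Row [e] of the transfer function times z^(-k), transported to [E]. *)
Definition edge_elt e k : E := \sum_i peC X e 0 i *:
  (<< (eshk X e + k, mxvec_index (esrc X e) i) >>
   - << (eshl X e + k, mxvec_index (etgt X e) i) >>).

Lemma pair_edge_elt u e k : pair u (edge_elt e k) = edge_form X u e k.
Proof.
rewrite pair_sum; apply: eq_bigr => i _; apply: (etrans (pairZ _ _ _)).
apply: (etrans (mulrC _ _)); apply: (congr1 (fun x => x * _)).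
apply: (etrans (pairB _ _ _)).
exact: (congr2 (fun x y => x - y) (pairU _ _ _ _) (pairU _ _ _ _)).
Qed.

Lemma translate_flex a u : is_flex X u -> is_flex X (translate a u).
Proof.
move=> /flexP uf; apply/flexP => e k; rewrite -[RHS](uf e (k + a)).
by apply: eq_bigr => i _; rewrite /translate !addrA.
Qed.

Definition fdiff (j : 'I_d) u : vfield := fun k => u (k + delta_mx 0 j) - u k.

Lemma fdiff_flex j u : is_flex X u -> is_flex X (fdiff j u).
Proof.
move=> uf; have /flexP tf := translate_flex (delta_mx 0 j) uf.
move/flexP: uf => uf; apply/flexP => e k.
transitivity (edge_form X (translate (delta_mx 0 j) u) e k - edge_form X u e k).
  rewrite /edge_form -sumrB; apply: eq_bigr => i _.
  by rewrite /fdiff /translate !mxE -mulrBl; congr (_ * _); rewrite !opprD; ring.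
by rewrite uf tf subr0.
Qed.

Lemma fdiff_comm i j u : fdiff i (fdiff j u) = fdiff j (fdiff i u).
Proof.
apply: funext => k; rewrite /fdiff (addrAC k (delta_mx 0 i)).
by apply/matrixP => v c; rewrite !mxE; ring.
Qed.

(** Shifting Laurent vectors is adjoint to translating fields, hence so are the two difference
    operators. *)
Lemma pair_fdiff j u N x :
  pair u (iter N (diffop (fun a => shift a : {linear E -> E}) (delta_mx 0 j)) x) =
  pair (iter N (fdiff j) u) x.
Proof.
elim: N u x => // N IH u x; rewrite [in RHS]iterSr -IH iterS /diffop.
move: (iter N _ x) => y; rewrite /pair linearB /= -/(pair _ _) pair_shift /pair /lext -sumrB.
apply: eq_bigr => k _; rewrite -scalerBr; congr (_ *: _).
by rewrite /fdiff linearB !mxE.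
Qed.

End NilpotentFlexes.

(** * From periodic flexes to all flexes *)

Section RigidityFromPeriodic.
Variables (R : realType) (d n m : nat) (X : crystal R d n m).
Local Notation C := (complex R).
Local Notation vfield := (vfield R d n).
Local Notation K := ('rV[int]_d * 'I_(n * d))%type.
Local Notation E := {malg C[K]}.
Implicit Types (u : vfield) (k l : 'rV[int]_d).
Hypothesis noflex : no_nontrivial_periodic_flexes X.

(** Apply the Nullstellensatz to the annihilator of all flexes. A character would give a nonzero
    factor-periodic flex with i-th multi-factor different from 1; it would be rigid by hypothesis,
    hence zero. One exponent serves all flexes, because nilpotency is modulo their common
    annihilator. *)
Lemma flex_nilpotent i :
  exists N, forall u, is_flex X u -> forall k, iter N (fdiff i) u k = 0.
Proof.
have [b bspan] := malg_countable_span C K.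
pose M := [set x : E | forall u, is_flex X u -> pair u x = 0].
have pair0 u : pair u 0 = 0 by rewrite /pair linear0.
have sM : submod (fun a => shift a : E -> E) M.
  split=> [u _|a x y hx hy u uf|a x hx u uf]; first exact: pair0.
    by rewrite pairP hx // hy // mulr0 addr0.
  by rewrite pair_shift hx //; apply: translate_flex.
have [[N hN]|[phi [chi [phil phiM [x0 phix0] phis chi1]]]] :=
  @nilpotent_or_character R E _ (fun a => shift a : {linear E -> E})
    (@shift_comm R d n) _ _ (@shift_generators R d n) b bspan (delta_mx 0 i) M sM.
  exists N => u uf k; apply/matrixP => v c; rewrite mxE -pairU -pair_fdiff.
  exact: hN.
pose u := field_of phi.
have uphi x : pair u x = phi x by apply: pair_field_of.
have uf : is_flex X u.
  by apply/flexP => e k; rewrite -pair_edge_elt uphi phiM // => u' /flexP; rewrite pair_edge_elt.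
pose w : 'rV[C]_d := \row_j chi (delta_mx 0 j).
have shiftNK a (x : E) : shift a (shift (- a) x) = x.
  rewrite (lext_unique (f := fun k : K => << k >> : E) (g := fun x => shift a (shift (- a) x))).
  - by rewrite /lext -malg_sumU.
  - by move=> c y z; rewrite (shiftP (- a) c y z) (shiftP a c).
  - by move=> [k j]; rewrite !shiftU /= subrK.
(* Shifts are invertible, so their eigenvalues are nonzero. *)
have w0 : nonzero_entries w.
  move=> j; rewrite mxE; apply: contra phix0 => /eqP c0.
  by rewrite -(shiftNK (delta_mx 0 j) x0) phis c0 mul0r.
have uw k : u k = zpow w k *: u 0.
  apply: factor_periodic_steps => // {}k j.
  by rewrite [w 0 j]mxE; apply: (field_of_shift phis).
have w1 : w != const_mx 1.
  by apply: contra chi1 => /eqP/rowP/(_ i); rewrite !mxE => ->.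
have u0 := factor_periodic_Frig0 w0 w1 uw (noflex.1 w u w0 (conj uf uw)).
case/eqP: phix0; rewrite -uphi /pair /lext big1 // => k _.
by rewrite u0 linear0 mxE scaler0.
Qed.

(** Write t(i,j,p) for the form. Alternating the two symmetries gives t(i,j,p) = t(j,i,p) =
    -t(p,i,j) = -t(i,p,j) = t(j,p,i) = t(p,j,i) = -t(i,j,p). *)
Lemma skew_symmetric0 (a : 'I_d -> 'rV[C]_d) (S : 'I_d -> 'M[C]_d) :
  (forall j, (S j)^T = - S j) -> (forall i j, a i *m S j = a j *m S i) ->
  forall i j p, a i *m S j *m (a p)^T = 0.
Proof.
move=> SS sym i j p.
have anti x y z : a x *m S y *m (a z)^T = - (a z *m S y *m (a x)^T).
  have tr11 (A : 'M[C]_1) : A^T = A by apply/matrixP => s t; rewrite mxE !ord1.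
  by rewrite -[LHS]tr11 !trmx_mul trmxK SS mulNmx mulmxN mulmxA.
have : a i *m S j *m (a p)^T = - (a i *m S j *m (a p)^T).
  rewrite {1}sym anti [a p *m _]sym anti opprK [a j *m _]sym.
  by rewrite -anti.
by move/eqP; rewrite -addr_eq0 -mulr2n -scaler_nat scaler_eq0 pnatr_eq0 => /eqP.
Qed.

Hypotheses (n0 : (0 < n)%N) (perU : cper X \in unitmx).

Lemma Frig_of_fdiff u : is_flex X u -> (forall j, in_Frig X (fdiff j u)) -> in_Frig X u.
Proof.
move=> uf h; pose v0 := Ordinal n0.
have /choice[S /choice[b Sb]] : forall j, exists S b, S^T = - S /\
    forall k, fdiff j u k = affine X S b k by move=> j; apply/FrigP.
(* The second difference in directions p and q is a_p S_q, and differences commute. *)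
have aS i j : row i (perC X) *m S j = row j (perC X) *m S i.
  have step p q : row v0 (fdiff p (fdiff q u) 0) = row p (perC X) *m S q.
    rewrite {1}/fdiff linearB /= !(Sb q).2 !rowK opprD addrACA subrr addr0 -mulmxBl.
    rewrite !placeCE add0r intvC0 mul0mx addr0 addrAC subrr add0r.
    by rewrite intvC_delta -rowE.
  by rewrite -!step fdiff_comm.
(* The trilinear form vanishes on the period vectors, which are a basis. *)
have S0 j : S j = 0.
  have := skew_symmetric0 (fun j => (Sb j).1) aS => t.
  have AU : perC X \in unitmx by rewrite map_unitmx.
  have AU' : (perC X)^T \in unitmx by rewrite unitmx_tr.
  have : perC X *m S j *m (perC X)^T = 0.
    apply/row_matrixP => i; rewrite row0 !row_mul; apply/rowP => k.
    have /matrixP/(_ 0 0) := t i j k; rewrite [in X in X -> _]mxE => z.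
    rewrite [RHS]mxE -[RHS](etrans z (mxE _ _ _ _)) mxE.
    by apply: eq_bigr => p _; rewrite !mxE.
  move/(congr1 (mulmx^~ (invmx (perC X)^T))); rewrite mulmxK // mul0mx.
  by move/(congr1 (mulmx (invmx (perC X)))); rewrite mulKmx // mulmx0.
(* The differences of [u] are now the constants [b j], so [u] is u(0) plus the sum of the k_j [b j]:
   a flexible lattice periodic flex. *)
apply: noflex.2; split => //; exists (\matrix_j b j)^T => k.
pose lin k : 'M[C]_(n, d) := \matrix_(v, i) (intvC R k *m (\matrix_j b j)) 0 i.
suff -> : u k = u 0 + lin k by rewrite trmxK.
have -> : u 0 = u k - lin k; last by rewrite subrK.
rewrite (@lattice_invariant _ _ (fun k => u k - lin k)).
  by rewrite -[LHS]subr0; congr (_ - _); apply/matrixP => v i; rewrite [RHS]mxE intvC0 mul0mx !mxE.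
move=> {}k j /=.
have -> : u (k + delta_mx 0 j) = fdiff j u k + u k by rewrite subrK.
have -> : lin (k + delta_mx 0 j) = fdiff j u k + lin k; last by rewrite opprD addrACA subrr add0r.
apply/row_matrixP => v; rewrite linearD /= (Sb j).2 S0 !rowK mulmx0 add0r intvCD mulmxDl addrC.
congr (_ + _).
by rewrite intvC_delta -rowE rowK.
Qed.

Lemma Frig_of_nilpotent u (N : 'I_d -> nat) : is_flex X u ->
  (forall i k, iter (N i) (fdiff i) u k = 0) -> in_Frig X u.
Proof.
have [s] := ubnP (\sum_i N i)%N; elim: s u N => // s IH u N Ns uf h.
have [/existsP[i /eqP Ni]|] := boolP [exists i, N i == 0%N].
  apply/FrigP; exists 0, 0; split; first by rewrite trmx0 oppr0.
  by move=> k; have := h i k; rewrite Ni /= affine0.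
rewrite negb_exists => /forallP N0; apply: Frig_of_fdiff => // j.
have NE : N j = (N j - 1).+1 by rewrite subn1 prednK // lt0n N0.
(* Taking the difference in direction j lowers the j-th order by one and keeps the others, since
   differences commute. *)
apply: (IH _ (fun i => N i - (i == j))%N); last 2 first.
- exact: fdiff_flex.
- move=> i k; have comm M v : iter M (fdiff i) (fdiff j v) = fdiff j (iter M (fdiff i) v).
    by elim: M => //= M ->; rewrite fdiff_comm.
  have [->|ij] := eqVneq i j; last first.
    by rewrite subn0 comm /fdiff !h subr0.
  by have := h j k; rewrite {1}NE iterSr.
- apply: (@leq_trans (\sum_i N i)%N) => //.
  rewrite [ltnRHS](bigD1 j) //= [ltnLHS](bigD1 j) //= eqxx -addSn -NE leq_add2l.
  by apply: leq_sum => i _; exact: leq_subr.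
Qed.

Lemma no_periodic_first_order_rigid : first_order_rigid X.
Proof.
move=> u; split=> [uf|]; last exact: Frig_flex.
have [N hN] := choice flex_nilpotent.
by apply: (@Frig_of_nilpotent u N) => // i k; apply: hN.
Qed.

End RigidityFromPeriodic.

(** * The rigidity module and duality *)

Section RigidityModule.
Variables (R : realType) (d n m : nat) (X : crystal R d n m).
Local Notation C := (complex R).
Local Notation vfield := (vfield R d n).
Local Notation lvec := (lvec R d n).
Local Notation lpoly := (lpoly R d).
Local Notation K := ('rV[int]_d * 'I_(n * d))%type.
Local Notation E := {malg C[K]}.
Implicit Types (u : vfield) (k l : 'rV[int]_d) (P Q : lvec).

(** Exponents are negated because [lpair] evaluates the field at -k. *)
Definition lelt P : E := \sum_(x <- P) \sum_j x.2 0 j *: << (- x.1, j) >>.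

Lemma pair_lelt u P : pair u (lelt P) = lpair P u.
Proof.
rewrite /pair linear_sum; apply: eq_bigr => x _; rewrite linear_sum mxE.
by apply: eq_bigr => j _; rewrite linearZ_LR /= lextU mxE.
Qed.

Lemma lelt_coef P k j : (lelt P)@_(- k, j) = lcoef P k 0 j.
Proof.
rewrite raddf_sum /lcoef summxE [RHS]big_mkcond; apply: eq_bigr => x _.
rewrite raddf_sum /= (bigD1 j) //= big1 => [|i ij].
  rewrite mcoeffZ mcoeffU -pair_eqE /= eqr_opp eqxx andbT addr0.
  by case: eqP => _; rewrite ?mulr1 ?mulr0.
by rewrite mcoeffZ mcoeffU -pair_eqE /= (negPf ij) andbF mulr0.
Qed.

Lemma lelt_eqP P Q : lelt P = lelt Q <-> forall k, lcoef P k = lcoef Q k.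
Proof.
split=> [h k|h]; first by apply/rowP => j; rewrite -!lelt_coef h.
by apply/malgP => -[k j]; rewrite -(opprK k) !lelt_coef h.
Qed.

Lemma lelt_nil : lelt [::] = 0.
Proof. exact: big_nil. Qed.

Lemma lelt_cons x P : lelt (x :: P) = \sum_j x.2 0 j *: << (- x.1, j) >> + lelt P.
Proof. exact: big_cons. Qed.

Lemma lelt_seq2 x y : lelt [:: x; y] =
  \sum_j x.2 0 j *: << (- x.1, j) >> + \sum_j y.2 0 j *: << (- y.1, j) >>.
Proof.
rewrite lelt_cons; congr (_ + _); rewrite lelt_cons lelt_nil; exact: addr0.
Qed.

Lemma lelt_cat P Q : lelt (P ++ Q) = lelt P + lelt Q.
Proof. exact: big_cat. Qed.

Lemma lelt_flatten (T : Type) (s : seq T) (f : T -> lvec) :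
  lelt (flatten [seq f e | e <- s]) = \sum_(e <- s) lelt (f e).
Proof.
by elim: s => [|e s IH]; rewrite /= ?big_nil ?big_cons ?lelt_cat ?IH // lelt_nil.
Qed.

(** Its range is the image of the module M(C) in [E]. *)
Definition psi (f : 'I_m -> lpoly) : E := \sum_e lelt (lmul (f e) (Psi_row X e)).

Lemma in_M_psi P : in_M X P <-> exists f, lelt P = psi f.
Proof.
have h f : psi f = lelt (flatten [seq lmul (f e) (Psi_row X e) | e <- enum 'I_m]).
  by rewrite lelt_flatten big_enum.
by split=> -[f hf]; exists f; [rewrite h; apply/lelt_eqP|apply/lelt_eqP; rewrite -h].
Qed.

Lemma sum_blk (V : lmodType C) v (p : 'rV[C]_d) (g : 'I_(n * d) -> V) :
  \sum_j (blk v p) 0 j *: g j = \sum_i p 0 i *: g (mxvec_index v i).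
Proof.
transitivity (\sum_w \sum_i (blk v p) 0 (mxvec_index w i) *: g (mxvec_index w i)).
  by rewrite pair_bigA (reindex _ (curry_mxvec_bij n d)); apply: eq_bigr => -[].
rewrite (bigD1 v) //= [X in _ + X]big1 ?addr0 => [|w wv].
  by apply: eq_bigr => i _; rewrite mxvecE mxE eqxx.
by rewrite big1 // => i _; rewrite mxvecE mxE (negPf wv) scale0r.
Qed.

Lemma lelt_Psi_term a c e : lelt (lmul [:: (a, c)] (Psi_row X e)) = c *: edge_elt X e (- a).
Proof.
have -> : lmul [:: (a, c)] (Psi_row X e) =
    [:: (a - eshk X e, c *: blk (esrc X e) (peC X e));
        (a - eshl X e, c *: - blk (etgt X e) (peC X e))] by [].
rewrite lelt_seq2.
have term b w (p : 'rV[C]_d) : \sum_j (c *: blk w p) 0 j *: (<< (b, j) >> : E) =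
    c *: \sum_i p 0 i *: << (b, mxvec_index w i) >>.
  rewrite -(sum_blk w p (fun j => << (b, j) >> : E)) scaler_sumr.
  by apply: eq_bigr => j _; rewrite mxE scalerA.
have termN b w (p : 'rV[C]_d) : \sum_j (c *: - blk w p) 0 j *: (<< (b, j) >> : E) =
    - (c *: \sum_i p 0 i *: << (b, mxvec_index w i) >>).
  rewrite -term; move: (blk w p) => B; rewrite -sumrN; apply: eq_bigr => j _.
  have -> : (c *: - B) 0 j = - (c *: B) 0 j by rewrite !mxE mulrN.
  exact: scaleNr.
apply: (etrans (congr2 +%R (term _ _ _) (termN _ _ _))); rewrite (opprB a) (opprB a).
apply: (etrans (esym (scalerBr _ _ _))); congr (_ *: _).
apply: (etrans (esym (sumrB _ _ _ _))); apply: eq_bigr => i _.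
exact: (esym (scalerBr _ _ _)).
Qed.

Lemma lmul_cons a f P : lmul (a :: f) P = lmul [:: a] P ++ lmul f P.
Proof. by rewrite /lmul /= cats0. Qed.

Lemma lelt_lmul f e : lelt (lmul f (Psi_row X e)) =
  \sum_(t <- f) t.2 *: edge_elt X e (- t.1).
Proof.
elim: f => [|[a c] f IH]; first by rewrite big_nil lelt_nil.
by rewrite lmul_cons lelt_cat IH lelt_Psi_term big_cons.
Qed.

Lemma in_M_flex P u : in_M X P -> is_flex X u -> lpair P u = 0.
Proof.
move=> /in_M_psi[f Pf] /flexP uf; rewrite -pair_lelt Pf.
rewrite pair_sum big1 //= => e _; rewrite lelt_lmul pair_sum big1 //= => t _.
by rewrite pairZ pair_edge_elt uf mulr0.
Qed.

Lemma lelt_lmul_cat f g e : lelt (lmul (f ++ g) (Psi_row X e)) =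
  lelt (lmul f (Psi_row X e)) + lelt (lmul g (Psi_row X e)).
Proof. by rewrite !lelt_lmul; apply: big_cat. Qed.

Lemma lelt_lmulZ a f e : lelt (lmul [seq (t.1, a * t.2) | t <- f] (Psi_row X e)) =
  a *: lelt (lmul f (Psi_row X e)).
Proof.
transitivity (\sum_(t <- f) (a * t.2) *: edge_elt X e (- t.1)).
  by rewrite lelt_lmul; apply: big_map.
rewrite lelt_lmul scaler_sumr; apply: eq_bigr => t _; exact: (esym (scalerA _ _ _)).
Qed.

Lemma psi_submod : submod (fun (i : void) (x : E) => x) (range psi).
Proof.
split=> [|a _ _ [f _ <-] [g _ <-]|//].
  exists (fun _ => [::]) => //; rewrite /psi big1 // => e _.
  by rewrite lelt_lmul big_nil.
exists (fun e => [seq (t.1, a * t.2) | t <- f e] ++ g e) => //.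
rewrite /psi scaler_sumr -big_split; apply: eq_bigr => e _.
by rewrite lelt_lmul_cat lelt_lmulZ.
Qed.

(** A functional that vanishes on M(C) is a flex, hence rigid, hence zero on every element of the
    rigidity module; so no such element can be separated from M(C). *)
Lemma rigid_module_eq : first_order_rigid X -> module_eq X.
Proof.
move=> rig P; split=> [PM u /rig|PF]; first exact: in_M_flex.
apply/in_M_psi; apply: contrapT => nP.
have [|phi [phil phiM phiP]] := @separating_functional _ _ _ _ _ (lelt P) psi_submod.
  by case=> f _ hf; apply: nP; exists f.
have uf : is_flex X (field_of phi).
  apply/flexP => e k; rewrite -pair_edge_elt pair_field_of //; apply: phiM.
  (* The monomial z^(-k) times row [e]. *)
  exists (fun e' => if e' == e then [:: (- k, 1)] else [::]) => //.
  rewrite /psi (bigD1 e) //= eqxx lelt_Psi_term opprK scale1r big1 ?addr0 // => e' /negPf ->.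
  by rewrite lelt_lmul big_nil.
have := PF _ (iffLR (rig _) uf); rewrite -pair_lelt pair_field_of // phiP.
by move/eqP; rewrite oner_eq0.
Qed.

Lemma lpair_cat P Q u : lpair (P ++ Q) u = lpair P u + lpair Q u.
Proof. exact: big_cat. Qed.

Lemma lpairZ a P u : lpair [seq (x.1, a *: x.2) | x <- P] u = a * lpair P u.
Proof.
rewrite /lpair big_map mulr_sumr; apply: eq_bigr => x _.
by rewrite -scalemxAl mxE.
Qed.

Lemma lpair_comb P a u v w : (forall k, u k = a *: v k + w k) ->
  lpair P u = a * lpair P v + lpair P w.
Proof.
move=> h; rewrite /lpair mulr_sumr -big_split; apply: eq_bigr => x _ /=.
by rewrite h linearP /= linearP /= mulmxDr -scalemxAr !mxE.
Qed.

Definition linclosed (F : vfield -> Prop) : Prop :=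
  F (fun=> 0) /\ forall a v w, F v -> F w -> F (fun k => a *: v k + w k).

Lemma lpair_linclosed P : linclosed (fun w => lpair P w = 0).
Proof.
split=> [|a v w v0 w0].
  by rewrite /lpair big1 // => x _; rewrite linear0 trmx0 mulmx0 mxE.
by rewrite (@lpair_comb P a _ v w) // v0 w0 mulr0 addr0.
Qed.

(** Gaussian elimination on the list. Membership in the span is expressed as membership in every
    linear subspace containing the list. *)
Lemma span_or_separated (fs : seq vfield) u :
  (forall F, linclosed F -> (forall v, inl v fs -> F v) -> F u) \/
  exists P, (forall v, inl v fs -> lpair P v = 0) /\ lpair P u != 0.
Proof.
elim: fs u => [|v fs IH] u.
  have [u0|] := pselect (forall k, u k = 0).
    by left=> F [F0 _] _; have -> : u = (fun=> 0) by apply: funext.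
  move=> /existsNP[k /eqP uk]; right.
  have [j uj] : exists j, (mxvec (u k)) 0 j != 0.
    by apply/rV0Pn; rewrite mxvec_eq0.
  (* Evaluation of a nonzero coordinate of [u k]. *)
  exists [:: (- k, delta_mx 0 j)]; split=> //.
  by rewrite /lpair big_cons big_nil addr0 /= opprK -rowE !mxE.
have [vs|[P0 [P0fs P0v]]] := IH v.
  have [us|[P [Pfs Pu]]] := IH u; last first.
    by right; exists P; split => // w [<-|/Pfs //]; apply: (vs _ (lpair_linclosed P)).
  by left=> F Fl Ffs; apply: us => // w ws; apply: Ffs; right.
(* With this [c], [P0] annihilates u - c v. *)
set c := lpair P0 u / lpair P0 v.
have [us|[P1 [P1fs P1u]]] := IH (fun k => - c *: v k + u k); last first.
  (* Correcting [P1] by a multiple of [P0] makes it vanish on [v]; its value at [u] is then that of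
     [P1] at u - c v. *)
  right; exists ([seq (x.1, (- (lpair P1 v / lpair P0 v)) *: x.2) | x <- P0] ++ P1); split.
    move=> w [<-|wfs]; rewrite lpair_cat lpairZ.
      by rewrite mulNr divfK // addNr.
    by rewrite (P0fs w wfs) (P1fs w wfs) mulr0 addr0.
  move: P1u; rewrite lpair_cat lpairZ (@lpair_comb P1 (- c) _ v u) //.
  by rewrite !mulNr /c mulrAC [_ * lpair P1 v]mulrC mulrAC.
left=> F Fl Ffs.
have -> : u = (fun k => c *: v k + (- c *: v k + u k)).
  by apply: funext => k; rewrite scaleNr addNKr.
case: (Fl) => _; apply; first by apply: Ffs; left.
by apply: us => // w ws; apply: Ffs; right.
Qed.

(** A finite spanning list with repetitions up to sign: all ordered pairs of indices occur, the
    diagonal ones giving 0. *)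
Definition rigid_basis : seq vfield :=
  [seq affine X (delta_mx ij.1 ij.2 - delta_mx ij.2 ij.1) 0 | ij <- enum {: 'I_d * 'I_d}] ++
  [seq affine X 0 (delta_mx 0 i) | i <- enum 'I_d].

Lemma inl_cat (T : Type) (x : T) s t : inl x (s ++ t) <-> inl x s \/ inl x t.
Proof. by elim: s => [|y s IH] /=; [tauto|rewrite IH; tauto]. Qed.

Lemma inl_map (T : eqType) (V : Type) (f : T -> V) s y :
  inl y [seq f x | x <- s] <-> exists2 x, x \in s & f x = y.
Proof.
elim: s => [|x s IH] /=; first by split=> // -[].
split=> [[<-|/IH[z zs <-]]|[z]].
- by exists x; rewrite ?mem_head.
- by exists z; rewrite // inE zs orbT.
- by rewrite inE => /predU1P[-> fy|zs fy]; [left|right; apply/IH; exists z].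
Qed.

Lemma Frig_linclosed : linclosed (in_Frig X).
Proof.
split=> [|a v w /FrigP[S [b [SS Sb]]] /FrigP[S' [b' [SS' Sb']]]]; apply/FrigP.
  by exists 0, 0; rewrite trmx0 oppr0; split => // k; rewrite affine0.
exists (a *: S + S'), (a *: b + b'); split; last by move=> k; rewrite Sb Sb' affineP.
by rewrite linearP /= SS SS' scalerN opprD.
Qed.

Lemma rigid_basis_Frig v : inl v rigid_basis -> in_Frig X v.
Proof.
move=> /inl_cat[/inl_map[[i j] _ <-]|/inl_map[i _ <-]]; apply/FrigP.
  exists (delta_mx i j - delta_mx j i), 0; split => //.
  by rewrite linearB /= !trmx_delta opprB.
by exists 0, (delta_mx 0 i); rewrite trmx0 oppr0.
Qed.

Lemma Frig_rigid_basis (F : vfield -> Prop) u : linclosed F ->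
  (forall v, inl v rigid_basis -> F v) -> in_Frig X u -> F u.
Proof.
move=> [F0 Fl] Fb /FrigP[S [b [SS ub]]].
pose WS := [set S : 'M[C]_d | F (affine X S 0)].
pose Wb := [set b : 'rV[C]_d | F (affine X 0 b)].
have a0 : affine X 0 0 = (fun=> 0) by apply: funext => k; rewrite affine0.
have sS : submod (fun (i : void) (x : 'M[C]_d) => x) WS.
  split=> // [|a S1 S2 h1 h2]; first by rewrite /WS /= a0.
  rewrite /WS /=; suff -> : affine X (a *: S1 + S2) 0 = (fun k => a *: affine X S1 0 k + affine X S2 0 k).
    exact: Fl.
  by apply: funext => k; rewrite -affineP scaler0 addr0.
have sb : submod (fun (i : void) (x : 'rV[C]_d) => x) Wb.
  split=> // [|a b1 b2 h1 h2]; first by rewrite /Wb /= a0.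
  rewrite /Wb /=; suff -> : affine X 0 (a *: b1 + b2) = (fun k => a *: affine X 0 b1 k + affine X 0 b2 k).
    exact: Fl.
  by apply: funext => k; rewrite -affineP scaler0 addr0.
have -> : u = (fun k => 1 *: affine X S 0 k + affine X 0 b k).
  by apply: funext => k; rewrite ub -affineP !scale1r addr0 add0r.
apply: Fl; last first.
  change (Wb b); rewrite [b]row_sum_delta; apply: (submod_sum _ sb) => i.
  apply: (submodZ _ sb); apply: Fb; apply/inl_cat; right; apply/inl_map.
  by exists i => //; rewrite mem_enum.
change (WS S).
(* Since S = (S - S^T)/2, summing over all ordered pairs counts each rotation twice. *)
have -> : S = 2^-1 *: \sum_i \sum_j S i j *: (delta_mx i j - delta_mx j i).
  have half : S = 2^-1 *: (S - S^T).
    have -> : S - S^T = 2 *: S by rewrite SS opprK scaler_nat mulr2n.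
    by rewrite scalerA mulVf ?scale1r // pnatr_eq0.
  rewrite {1}half; congr (_ *: _).
  under eq_bigr => i _ do (under eq_bigr => j _ do rewrite scalerBr; rewrite sumrB).
  rewrite sumrB -matrix_sum_delta; congr (_ - _).
  rewrite [LHS]matrix_sum_delta exchange_big; apply: eq_bigr => i _.
  by apply: eq_bigr => j _; rewrite mxE.
apply: (submodZ _ sS); apply: (submod_sum _ sS) => i.
apply: (submod_sum _ sS) => j; apply: (submodZ _ sS); apply: Fb.
apply/inl_cat; left; apply/inl_map; exists (i, j) => //.
by rewrite mem_enum.
Qed.

(** A flex outside the span of the rigid motions would be detected by some [P] in the rigidity
    module; but [P] then lies in M(C), which annihilates flexes. *)
Lemma module_eq_rigid : module_eq X -> first_order_rigid X.
Proof.
move=> hM u; split=> [uf|]; last exact: Frig_flex.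
have [span|[P [Pb Pu]]] := span_or_separated rigid_basis u.
  by apply: span; [exact: Frig_linclosed|exact: rigid_basis_Frig].
case/eqP: Pu; apply: (in_M_flex _ uf); apply/hM => w.
exact: (Frig_rigid_basis (lpair_linclosed P)).
Qed.

End RigidityModule.

(** Rank-nullity: the rows of [D] span an r-dimensional part of the kernel, and the rank is N - r
    exactly when this is all of it. In the three rank conditions [D] is empty, the translations, or
    all rigid motions. *)
Lemma rank_kernel (F : fieldType) m N r (A : 'M[F]_(m, N)) (D : 'M[F]_(r, N)) :
  row_free D -> D *m A^T = 0 ->
  (\rank A = (N - r)%N <-> forall y : 'rV_N, y *m A^T = 0 -> (y <= D)%MS).
Proof.
move=> fD DA; have DK : (D <= kermx A^T)%MS by apply/sub_kermxP.
have [le eqD] := mxrank_leqif_sup DK.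
move: le eqD; rewrite mxrank_ker mxrank_tr (eqP fD) => le eqD.
have rA := rank_leq_col A.
split=> [rk y yA|h].
  apply: (@submx_trans _ _ _ _ _ _ (kermx A^T)); first exact/sub_kermxP.
  by rewrite -eqD rk; apply/eqP; lia.
have : (kermx A^T <= D)%MS.
  by apply/row_subP => i; apply: h; apply/sub_kermxP; apply: row_sub.
by rewrite -eqD => /eqP; lia.
Qed.

(** The dimension of the space of skew-symmetric matrices. *)
Lemma card_ltn_pairs d : #|[pred p : 'I_d * 'I_d | (p.1 < p.2)%N]| = ((d * d.-1) %/ 2)%N.
Proof.
rewrite -sum1_card divn2 -bin2 -bin2_sum big_mkord.
rewrite -(pair_big_dep xpredT (fun i j : 'I_d => (i < j)%N) (fun _ _ => 1%N)) /=.
rewrite (exchange_big_dep xpredT) //=; apply: eq_bigr => j _.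
by rewrite -(big_ord_widen d (fun=> 1%N) (ltnW (ltn_ord j))) sum1_card card_ord.
Qed.

(** * Ranks of the transfer function *)

Section Ranks.
Variables (R : realType) (d n m : nat) (X : crystal R d n m).
Local Notation C := (complex R).
Local Notation vfield := (vfield R d n).
Implicit Types (u : vfield) (k l : 'rV[int]_d) (U : 'M[C]_(n, d)) (Y S : 'M[C]_d).

Lemma mxvec_blk U v (p : 'rV[C]_d) :
  \sum_j mxvec U 0 j * (blk v p) 0 j = \sum_i U v i * p 0 i.
Proof.
transitivity (\sum_j (blk v p) 0 j *: (mxvec U 0 j : C^o)).
  by apply: eq_bigr => j _; apply: mulrC.
by rewrite sum_blk; apply: eq_bigr => i _; rewrite mxvecE; apply: mulrC.
Qed.

Lemma Psi_at_row (z : 'rV[C]_d) U e : (mxvec U *m (Psi_at X z)^T) 0 e =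
  \sum_i (zpow z (- eshk X e) * U (esrc X e) i - zpow z (- eshl X e) * U (etgt X e) i)
     * peC X e 0 i.
Proof.
rewrite mxE; transitivity (zpow z (- eshk X e) * \sum_j mxvec U 0 j * (blk (esrc X e) (peC X e)) 0 j
  - zpow z (- eshl X e) * \sum_j mxvec U 0 j * (blk (etgt X e) (peC X e)) 0 j).
  rewrite !mulr_sumr -sumrB; apply: eq_bigr => j _; rewrite [_^T _ _]mxE [Psi_at _ _ _ _]mxE.
  rewrite /lveval !big_cons big_nil addr0 /=.
  move: (blk (esrc X e) _) (blk (etgt X e) _) => B B'.
  by rewrite !mxE; ring.
rewrite !mxvec_blk !mulr_sumr -sumrB; apply: eq_bigr => i _; by rewrite mulrBl !mulrA.
Qed.

(** The rows carry z^(-k), so kernel vectors at z are flexes with multi-factor z^(-1). This explains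
    the entrywise inverses that follow. *)
Lemma Psi_kernel (z : 'rV[C]_d) U : nonzero_entries z ->
  mxvec U *m (Psi_at X z)^T = 0 <-> is_flex X (fun k => zpow z (- k) *: U).
Proof.
move=> z0.
have ef e k : edge_form X (fun k => zpow z (- k) *: U) e k =
    zpow z (- k) * (mxvec U *m (Psi_at X z)^T) 0 e.
  rewrite Psi_at_row mulr_sumr; apply: eq_bigr => i _.
  by rewrite mxE [X in _ - X]mxE !opprD !zpowD //; ring.
split=> [h|/flexP h]; first by apply/flexP => e k; rewrite ef h mxE mulr0.
apply/rowP => e; have := h e 0; rewrite ef oppr0 zpow0 mul1r => ->.
by rewrite mxE.
Qed.

Lemma zpow_inv (z : 'rV[C]_d) k : zpow (map_mx GRing.inv z) k = zpow z (- k).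
Proof. by apply: eq_bigr => i _; rewrite !mxE exprz_inv. Qed.

Lemma map_inv_neq0 (z : 'rV[C]_d) : nonzero_entries z -> nonzero_entries (map_mx GRing.inv z).
Proof. by move=> z0 i; rewrite mxE invr_eq0. Qed.

Lemma map_invK (z : 'rV[C]_d) : map_mx GRing.inv (map_mx GRing.inv z) = z.
Proof. by apply/rowP => i; rewrite !mxE invrK. Qed.

Lemma map_inv1 (z : 'rV[C]_d) : (map_mx GRing.inv z == const_mx 1) = (z == const_mx 1).
Proof.
have inv1 : map_mx GRing.inv (const_mx 1 : 'rV[C]_d) = const_mx 1.
  by apply/rowP => i; rewrite !mxE invr1.
by apply/eqP/eqP => [h|->//]; rewrite -(map_invK z) h inv1.
Qed.

Definition trans_mx : 'M[C]_(d, n * d) := \matrix_i mxvec (\matrix_(v < n) delta_mx 0 i).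

Lemma mul_trans_mx (b : 'rV[C]_d) : b *m trans_mx = mxvec (\matrix_(v < n) b).
Proof.
rewrite mulmx_sum_row.
under eq_bigr => i _ do rewrite rowK -linearZ.
rewrite -linear_sum; congr mxvec; apply/row_matrixP => v; rewrite linear_sum rowK /=.
rewrite [RHS]row_sum_delta; apply: eq_bigr => i _.
by rewrite linearZ /= rowK.
Qed.

Lemma zpow1 k : zpow (const_mx 1 : 'rV[C]_d) k = 1.
Proof. by rewrite /zpow big1 // => i _; rewrite mxE exp1rz. Qed.

Lemma nonzero1 : nonzero_entries (const_mx 1 : 'rV[C]_d).
Proof. by move=> i; rewrite mxE oner_neq0. Qed.

Lemma trans_Frig (b : 'rV[C]_d) : in_Frig X (fun=> \matrix_(v < n) b).
Proof.
apply/FrigP; exists 0, b; rewrite trmx0 oppr0; split => // k.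
by apply/row_matrixP => v; rewrite !rowK mulmx0 add0r.
Qed.

Hypotheses (n0 : (0 < n)%N) (perU : cper X \in unitmx).

Lemma row_free_trans_mx : row_free trans_mx.
Proof.
rewrite -kermx_eq0; apply/rowV0P => b /sub_kermxP; rewrite mul_trans_mx => /eqP.
rewrite mxvec_eq0 => /eqP /row_matrixP /(_ (Ordinal n0)).
by rewrite rowK row0.
Qed.

(** Away from z = 1 a rigid factor-periodic field is zero, so the kernel must be trivial. *)
Lemma Psi_rank_neq1P (z : 'rV[C]_d) : nonzero_entries z -> z != const_mx 1 ->
  \rank (Psi_at X z) = (n * d)%N <->
  forall u, is_flex X u -> (forall k, u k = zpow (map_mx GRing.inv z) k *: u 0) -> in_Frig X u.
Proof.
move=> z0 z1.
have := @rank_kernel _ _ _ _ (Psi_at X z) (0 : 'M[C]_(0, n * d)).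
rewrite /row_free mxrank0 mul0mx subn0 => -> //; split=> h.
  move=> u uf uw; have u0 : u 0 = 0.
    apply: (can_inj (@mxvecK _ _ _)); rewrite linear0.
    apply: submx0null (h _ _); apply/(Psi_kernel _ z0); have -> : (fun k => zpow z (- k) *: u 0) = u => //.
    by apply: funext => k; rewrite [RHS]uw zpow_inv.
  apply/FrigP; exists 0, 0; rewrite trmx0 oppr0; split => // k.
  by rewrite uw u0 scaler0 affine0.
move=> y; rewrite -{1}(vec_mxK y) => /(Psi_kernel _ z0) yf.
have yw k : zpow z (- k) *: vec_mx y =
    zpow (map_mx GRing.inv z) k *: (zpow z (- 0) *: vec_mx y).
  by rewrite oppr0 zpow0 scale1r zpow_inv.
have w1 : map_mx GRing.inv z != const_mx 1 by rewrite map_inv1.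
have /= := factor_periodic_Frig0 (map_inv_neq0 z0) w1 yw (h _ yf yw) 0.
rewrite oppr0 zpow0 scale1r => y0.
by rewrite -(vec_mxK y) y0 linear0 sub0mx.
Qed.

Lemma Psi_rank1P : \rank (Psi_at X (const_mx 1)) = (n * d - d)%N <->
  forall u, is_flex X u -> (forall k, u k = u 0) -> in_Frig X u.
Proof.
have kerP U : mxvec U *m (Psi_at X (const_mx 1))^T = 0 <-> is_flex X (fun=> U).
  rewrite (Psi_kernel _ nonzero1).
  have -> // : (fun k => zpow (const_mx 1) (- k) *: U) = (fun=> U).
  by apply: funext => k; rewrite zpow1 scale1r.
rewrite (@rank_kernel _ _ _ _ _ trans_mx row_free_trans_mx); last first.
  apply/row_matrixP => i; rewrite row_mul row0 rowK; apply/kerP.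
  exact/Frig_flex/trans_Frig.
split=> h.
  move=> u uf uc; have /submxP[b] : (mxvec (u 0) <= trans_mx)%MS.
    apply: h; apply/kerP; have -> // : (fun=> u 0) = u.
    by apply: funext => k; rewrite -(uc k).
  rewrite mul_trans_mx => /(can_inj (@mxvecK _ _ _)) ub.
  have -> : u = (fun=> \matrix_(v < n) b) by apply: funext => k; rewrite uc ub.
  exact: trans_Frig.
move=> y; rewrite -{1}(vec_mxK y) => /kerP yf.
have /FrigP[S [b [SS Sb]]] := h _ yf (fun=> erefl).
(* A rigid motion that is constant on the translates of a vertex satisfies a_i S = 0 for every
   period vector, and these form a basis. *)
suff S0 : S = 0.
  apply/submxP; exists b; rewrite mul_trans_mx -(vec_mxK y) (Sb 0); congr mxvec.
  by apply/row_matrixP => v; rewrite !rowK S0 mulmx0 add0r.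
have AU : perC X \in unitmx by rewrite map_unitmx.
suff : perC X *m S = 0.
  by move/(congr1 (mulmx (invmx (perC X)))); rewrite mulKmx // mulmx0.
apply/row_matrixP => i; rewrite row_mul row0.
have := etrans (esym (Sb (delta_mx 0 i))) (Sb 0).
move/row_matrixP/(_ (Ordinal n0)); rewrite !rowK => /addIr.
rewrite !placeCE intvC0 mul0mx addr0 mulmxDl => /eqP; rewrite -subr_eq0 addrAC subrr add0r.
by rewrite intvC_delta -rowE => /eqP.
Qed.

End Ranks.

(** * The flexible lattice matrix and the equivalence of periodic flexes with ranks *)

Section FlexibleLattice.
Variables (R : realType) (d n m : nat) (X : crystal R d n m).
Local Notation C := (complex R).
Local Notation vfield := (vfield R d n).
Local Notation N := (n * d + d * d)%N.
Implicit Types (u : vfield) (k l : 'rV[int]_d) (U : 'M[C]_(n, d)) (Y S : 'M[C]_d).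

(** The minus sign matches the coefficients l - k, and not k - l, in the last columns of
    [R_fper]. *)
Definition lattice_field U Y : vfield := fun k => \matrix_v (row v U - intvC R k *m Y).

Definition lattice_vec U Y : 'rV[C]_N := row_mx (mxvec U) (mxvec Y).

Lemma sum_mxvec p q (A B : 'M[C]_(p, q)) :
  (mxvec A *m (mxvec B)^T) 0 0 = \sum_i \sum_j A i j * B i j.
Proof.
rewrite mxE pair_bigA (reindex _ (curry_mxvec_bij p q)).
by apply: eq_bigr => -[i j] _; rewrite [_^T _ _]mxE !mxvecE.
Qed.

Lemma R_fper_row U Y e :
  (lattice_vec U Y *m (map_mx (@toC R) (R_fper X))^T) 0 e =
  edge_form X (lattice_field U Y) e 0.
Proof.
have -> : (lattice_vec U Y *m (map_mx (@toC R) (R_fper X))^T) 0 e =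
    (lattice_vec U Y *m (row e (map_mx (@toC R) (R_fper X)))^T) 0 0.
  by rewrite [LHS]mxE [RHS]mxE; apply: eq_bigr => j _; rewrite !mxE.
rewrite /R_fper map_row_mx row_row_mx tr_row_mx mul_row_col -!map_row !rowK.
rewrite !map_mxvec [LHS]mxE !sum_mxvec.
rewrite /edge_form !addr0.
transitivity (\sum_i (U (esrc X e) i - U (etgt X e) i) * peC X e 0 i +
  \sum_i ((intvC R (eshl X e) - intvC R (eshk X e)) *m Y) 0 i * peC X e 0 i); last first.
  rewrite -big_split; apply: eq_bigr => i _ /=; rewrite -mulrDl; congr (_ * _).
  rewrite mulmxBl [in RHS]mxE [X in _ = _ - X]mxE [X in _ = X - _]mxE.
  by rewrite !mxE; ring.
congr (_ + _).
  rewrite exchange_big; apply: eq_bigr => i _.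
  have sel (v0 : 'I_n) : \sum_v U v i * (v == v0)%:R = U v0 i.
    rewrite (bigD1 v0) //= eqxx mulr1 big1 ?addr0 // => v /negPf ->.
    by rewrite mulr0.
  rewrite mulrBl -{1}(sel (esrc X e)) -{1}(sel (etgt X e)) !mulr_suml -sumrB.
  apply: eq_bigr => v _; rewrite !mxE rmorphM rmorphB !rmorph_nat; ring.
rewrite exchange_big; apply: eq_bigr => i _; rewrite [in RHS]mxE mulr_suml.
apply: eq_bigr => j _; rewrite !mxE rmorphM rmorph_int intrB; ring.
Qed.

Lemma lattice_field_edge_form U Y e k :
  edge_form X (lattice_field U Y) e k = edge_form X (lattice_field U Y) e 0.
Proof.
have E l : lattice_field U Y (l + k) = lattice_field U Y (l + 0) - \matrix_(v < n) (intvC R k *m Y).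
  by apply/row_matrixP => v; rewrite linearB /= !rowK addr0 intvCD mulmxDl opprD addrA.
have D l v i : lattice_field U Y (l + k) v i = lattice_field U Y (l + 0) v i - (intvC R k *m Y) 0 i.
  by rewrite E; move: (lattice_field _ _ _) (_ *m _) => A B; rewrite !mxE.
have aux (x y z : C) : x - z - (y - z) = x - y by ring.
rewrite /edge_form; apply: eq_bigr => i _; apply: (congr1 (fun x => x * _)).
exact: (etrans (congr2 (fun x y => x - y) (D _ _ _) (D _ _ _)) (aux _ _ _)).
Qed.

Lemma R_fper_kernel U Y : lattice_vec U Y *m (map_mx (@toC R) (R_fper X))^T = 0 <->
  is_flex X (lattice_field U Y).
Proof.
split=> [h|/flexP h].
  by apply/flexP => e k; rewrite lattice_field_edge_form -R_fper_row h mxE.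
by apply/rowP => e; rewrite R_fper_row h mxE.
Qed.

Lemma lattice_field0 U Y : lattice_field U Y 0 = U.
Proof. by apply/row_matrixP => v; rewrite rowK intvC0 mul0mx subr0. Qed.

Lemma lattice_field_flexible U Y : is_flex X (lattice_field U Y) ->
  flexible_lattice_periodic_flex X (lattice_field U Y).
Proof.
move=> uf; split => //; exists (- Y)^T => k; rewrite lattice_field0 trmxK.
apply/row_matrixP => v; by rewrite linearD /= !rowK mulmxN.
Qed.

Lemma flexible_lattice_field u : flexible_lattice_periodic_flex X u ->
  exists Y, u = lattice_field (u 0) Y.
Proof.
case=> _ [Z uZ]; exists (- Z^T); apply: funext => k.
by apply/row_matrixP => v; rewrite rowK uZ linearD /= rowK mulmxN opprK.
Qed.

(** The coordinates in the kernel of [R_fper] of a rigid motion. *)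
Definition affine_vec S (b : 'rV[C]_d) : 'rV[C]_N :=
  lattice_vec (affine X S b 0) (- (perC X *m S)).

Lemma affine_lattice_field S b : affine X S b = lattice_field (affine X S b 0) (- (perC X *m S)).
Proof.
apply: funext => k; apply/row_matrixP => v; rewrite !rowK !placeCE intvC0 mul0mx addr0.
by rewrite mulmxN opprK mulmxDl addrAC mulmxA.
Qed.

Lemma affine_vecP a S S' (b b' : 'rV[C]_d) :
  affine_vec (a *: S + S') (a *: b + b') = a *: affine_vec S b + affine_vec S' b'.
Proof.
rewrite /affine_vec /lattice_vec scale_row_mx add_row_mx affineP linearP; congr row_mx.
by rewrite -linearP mulmxDr -scalemxAr opprD scalerN.
Qed.

Lemma affine_vec_sum (I : Type) (s : seq I) (a : I -> C) (f : I -> 'M[C]_d * 'rV[C]_d) :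
  \sum_(i <- s) a i *: affine_vec (f i).1 (f i).2 =
  affine_vec (\sum_(i <- s) a i *: (f i).1) (\sum_(i <- s) a i *: (f i).2).
Proof.
elim: s => [|i s IH]; last by rewrite !big_cons IH affine_vecP.
rewrite !big_nil /affine_vec /lattice_vec affine0 mulmx0 oppr0 !linear0.
by rewrite row_mx0.
Qed.

Local Notation ltp := [pred p : 'I_d * 'I_d | (p.1 < p.2)%N].

Definition skewE (p : 'I_d * 'I_d) : 'M[C]_d := delta_mx p.1 p.2 - delta_mx p.2 p.1.

Lemma skewE_decomp S : S^T = - S ->
  S = \sum_(q < #|ltp|) S (enum_val q).1 (enum_val q).2 *: skewE (enum_val q).
Proof.
move=> SS; rewrite -(big_enum_val (A := ltp) (fun p => S p.1 p.2 *: skewE p)).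
(* The strict upper triangle of [S]; the diagonal of [S] is zero. *)
pose V := \matrix_(i, j) if (i < j)%N then S i j else 0.
have skew i j : S j i = - S i j.
  by have := congr1 (fun M : 'M_d => M i j) SS; rewrite !mxE.
have SV : S = V - V^T.
  apply/matrixP => i j; rewrite !mxE; case: ltngtP => [_|_|/val_inj ->].
  - by rewrite subr0.
  - by rewrite sub0r skew.
  - have /eqP := skew j j; rewrite -addr_eq0 -mulr2n mulrn_eq0 /= => /eqP ->.
    by rewrite subr0.
have sumV : V = \sum_(p in ltp) S p.1 p.2 *: delta_mx p.1 p.2.
  rewrite [LHS]matrix_sum_delta pair_bigA [RHS]big_mkcond; apply: eq_bigr => p _.
  by rewrite mxE inE; case: ifP => // _; rewrite scale0r.
have sumVT : V^T = \sum_(p in ltp) S p.1 p.2 *: delta_mx p.2 p.1.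
  rewrite sumV linear_sum; apply: eq_bigr => p _.
  by rewrite linearZ /= trmx_delta.
rewrite {1}SV {1}sumV sumVT -sumrB; apply: eq_bigr => p _.
by rewrite -scalerBr.
Qed.

Lemma skewE_free (x : 'rV[C]_#|ltp|) :
  \sum_(q < #|ltp|) x 0 q *: skewE (enum_val q) = 0 -> x = 0.
Proof.
move=> h; apply/rowP => q0; rewrite [RHS]mxE.
have lt q : ((enum_val (A := ltp) q).1 < (enum_val q).2)%N by have := enum_valP q.
have /matrixP/(_ (enum_val q0).1 (enum_val q0).2) := h.
rewrite summxE [RHS]mxE (bigD1 q0) //= big1 ?addr0 => [|q qq0].
  rewrite !mxE !eqxx /= (ltn_eqF (lt q0) : (enum_val q0).1 == (enum_val q0).2 = false).
  by rewrite subr0 mulr1.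
rewrite !mxE; have -> : ((enum_val q0).1 == (enum_val q).1) && ((enum_val q0).2 == (enum_val q).2) = false.
  apply/negP => /andP[/eqP e1 /eqP e2]; case/eqP: qq0; apply: enum_val_inj.
  by apply/esym; rewrite [LHS]surjective_pairing [RHS]surjective_pairing e1 e2.
have -> : ((enum_val q0).1 == (enum_val q).2) && ((enum_val q0).2 == (enum_val q).1) = false.
  apply/negP => /andP[/eqP e1 /eqP e2]; have := lt q0; rewrite e1 e2.
  by have := lt q; lia.
by rewrite subr0 mulr0.
Qed.

(** The d(d-1)/2 elementary rotations followed by the d translations: a basis of the trivial part of
    the kernel. *)
Definition rigid_mx : 'M[C]_(#|ltp| + d, N) :=
  col_mx (\matrix_q affine_vec (skewE (enum_val q)) 0) (\matrix_i affine_vec 0 (delta_mx 0 i)).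

Lemma mul_rigid_mx (x : 'rV[C]_#|ltp|) (b : 'rV[C]_d) : row_mx x b *m rigid_mx =
  affine_vec (\sum_(q < #|ltp|) x 0 q *: skewE (enum_val q)) b.
Proof.
rewrite mul_row_col !mulmx_sum_row.
under eq_bigr => q _ do rewrite rowK.
under [X in _ + X]eq_bigr => i _ do rewrite rowK.
rewrite (affine_vec_sum _ (fun q => x 0 q) (fun q => (skewE (enum_val q), 0))) /=.
rewrite (affine_vec_sum _ (fun i => b 0 i) (fun i => (0, delta_mx 0 i))) /=.
rewrite [X in affine_vec _ X + _]big1 => [|q _]; last exact: scaler0.
rewrite [X in _ + affine_vec X _]big1 => [|i _]; last exact: scaler0.
rewrite -[affine_vec _ 0]scale1r -affine_vecP scale1r scaler0 addr0 add0r.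
by rewrite -row_sum_delta.
Qed.

Lemma skewE_sum_skew (x : 'rV[C]_#|ltp|) :
  (\sum_(q < #|ltp|) x 0 q *: skewE (enum_val q))^T =
  - \sum_(q < #|ltp|) x 0 q *: skewE (enum_val q).
Proof.
rewrite linear_sum -sumrN; apply: eq_bigr => q _.
by rewrite linearZ /= linearB /= !trmx_delta -scalerN opprB.
Qed.

Hypotheses (n0 : (0 < n)%N) (perU : cper X \in unitmx).

Lemma row_free_rigid_mx : row_free rigid_mx.
Proof.
rewrite -kermx_eq0; apply/rowV0P => y /sub_kermxP.
rewrite -(hsubmxK y) mul_rigid_mx; move: (lsubmx y) (rsubmx y) => x b.
set S := \sum_(q < _) _ => h.
have [U0 Y0] : mxvec (affine X S b 0) = 0 /\ mxvec (- (perC X *m S)) = 0.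
  by apply: eq_row_mx; rewrite row_mx0.
have AU : perC X \in unitmx by rewrite map_unitmx.
have S0 : S = 0.
  have /eqP : perC X *m S = 0.
    by apply/eqP; rewrite -oppr_eq0 -mxvec_eq0 Y0.
  by move/eqP/(congr1 (mulmx (invmx (perC X)))); rewrite mulKmx // mulmx0.
have b0 : b = 0.
  have /eqP := U0; rewrite mxvec_eq0 => /eqP/row_matrixP/(_ (Ordinal n0)).
  by rewrite rowK S0 mulmx0 add0r row0.
by rewrite b0 (skewE_free S0) row_mx0.
Qed.

Lemma R_fper_rankP : \rank (R_fper X) = (n * d + (d * d.-1) %/ 2)%N <->
  forall u, flexible_lattice_periodic_flex X u -> in_Frig X u.
Proof.
(* The identity d^2 - d(d-1)/2 - d = d(d-1)/2; one of d and d-1 is even, so the halving is exact. *)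
have -> : (n * d + (d * d.-1) %/ 2 = N - (#|ltp| + d))%N.
  rewrite card_ltn_pairs.
  have : ((d * d.-1) %/ 2 * 2 = d * d.-1)%N.
    apply: divnK; rewrite dvdn2 oddM; case: (d) => [//|k] /=.
    by case: (odd k).
  move: (_ %/ 2)%N => c; case: (d) => [|k] /=; nia.
rewrite -(mxrank_map (@toC R)) (rank_kernel row_free_rigid_mx); last first.
  apply/row_matrixP => i; rewrite row0 rowE mulmxA -(hsubmxK (delta_mx 0 i)) mul_rigid_mx.
  move: (lsubmx _) (rsubmx _) => x b; apply/R_fper_kernel.
  rewrite -affine_lattice_field; apply/Frig_flex/FrigP; exists (\sum_q x 0 q *: skewE (enum_val q)), b.
  by split => //; apply: skewE_sum_skew.
split=> h.
  move=> u uf; have [Y uY] := flexible_lattice_field uf.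
  have /submxP[y] : (lattice_vec (u 0) Y <= rigid_mx)%MS.
    by apply: h; apply/R_fper_kernel; rewrite -uY; case: uf.
  rewrite -(hsubmxK y) mul_rigid_mx; set S := \sum_(q < _) _ => /eq_row_mx[].
  move=> /(can_inj (@mxvecK _ _ _)) u0 /(can_inj (@mxvecK _ _ _)) Y0.
  apply/FrigP; exists S, (rsubmx y); split; first exact: skewE_sum_skew.
  by move=> k; rewrite uY u0 Y0 -affine_lattice_field.
move=> y; rewrite -(hsubmxK y) -(vec_mxK (lsubmx y)) -(vec_mxK (rsubmx y)).
move: (vec_mx (lsubmx y)) (vec_mx (rsubmx y)) => U Y /R_fper_kernel uf.
have /FrigP[S [b [SS ub]]] := h _ (lattice_field_flexible uf).
have e : lattice_field U Y = affine X S b by apply: funext.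
apply/submxP; exists (row_mx (\row_q S (enum_val q).1 (enum_val q).2) b).
rewrite mul_rigid_mx.
under eq_bigr => q _ do rewrite mxE.
rewrite -(skewE_decomp SS) /affine_vec -e lattice_field0; congr row_mx; congr mxvec.
have U0 : affine X S b 0 = U by rewrite -e lattice_field0.
have e' : lattice_field U Y = lattice_field U (- (perC X *m S)).
  by rewrite e affine_lattice_field U0.
(* Row i of [Y] is read off at the first vertex from the velocity at the i-th lattice generator. *)
apply/row_matrixP => i.
have := congr1 (fun w : vfield => row (Ordinal n0) (w (delta_mx 0 i))) e'.
rewrite !rowK => /addrI/oppr_inj.
by rewrite intvC_delta -!rowE.
Qed.

(** The three rank conditions cover in turn the multi-factors different from 1, through w = z^(-1),
    the multi-factor 1, and the flexible lattice flexes. *)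
Lemma rank_extremalP : no_nontrivial_periodic_flexes X <-> rank_extremal X.
Proof.
split=> [[hf hl]|[hz h1 hR]].
  split; last exact/R_fper_rankP.
    move=> z z0 z1; apply/(Psi_rank_neq1P X z0 z1) => u uf uw.
    exact: (hf _ _ (map_inv_neq0 z0)).
  apply/(Psi_rank1P n0 perU) => u uf uc; apply: (hf _ _ (@nonzero1 R d)); split => // k.
  by rewrite zpow1 scale1r.
split; last exact/R_fper_rankP.
move=> w u w0 [uf uw]; have [w1|w1] := eqVneq w (const_mx 1).
  apply: (iffLR (Psi_rank1P n0 perU) h1 u uf) => k.
  by rewrite uw w1 zpow1 scale1r.
have z1 : map_mx GRing.inv w != const_mx 1 by rewrite map_inv1.
have z0 := map_inv_neq0 w0.
apply: (iffLR (Psi_rank_neq1P X z0 z1) (hz _ z0 z1) u uf) => k.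
by rewrite map_invK.
Qed.

End FlexibleLattice.

(** * The cycle of equivalences *)

Theorem theorem3p2 (R : realType) (d n m : nat) (X : crystal R d n m) :
  (2 <= d)%N -> (0 < n)%N -> is_crystal X ->
  [<-> first_order_rigid X; exp_rigid X; no_nontrivial_periodic_flexes X;
       rank_extremal X; module_eq X].
Proof.
move=> _ n0 [perU _ _ _]; tfae.
- exact: first_order_exp_rigid.
- exact: exp_rigid_no_periodic.
- by move/(rank_extremalP n0 perU).
(* From (iv) back to (iii), then to (i) by nilpotency of differences, then to (v) by duality. *)
- move/(rank_extremalP n0 perU) => h.
  exact/rigid_module_eq/no_periodic_first_order_rigid.
- exact: module_eq_rigid.
Qed.
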